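(* Let $b\ge 2$ and $j\ge 2$ be integers, and let $X$ be a Pareto random variable with minimum value $x_{\mathrm m}>0$ and shape parameter $s>0$. Put $\rho=\{\log_b x_{\mathrm m}\}$, $\xi=\rho+j-1$, and $\eta_v=\lceil b^{\xi-1}-v b^{-1}\rceil$. Let $\tau_s(v)=-\psi(v)$ if $s=1$ and $\tau_s(v)=\zeta(s,v)$ if $s\ne 1$. Let $A_{[j]}$ be the $j$-th most significant $b$-ary digit of $X$. Then for every $a\in\{0,1,\ldots,b-1\}$, $$\begin{aligned}\Pr(A_{[j]}=a)&=\frac{b^{s(\xi-2)}}{1-b^{-s}}\Big(\tau_s(ab^{-1}+b^{j-2})-\tau_s((a+1)b^{-1}+b^{j-2})\Big)\\&\quad-\frac{b^{s(\xi-1)}}{1-b^{-s}}\Big(\tau_s(ab^{-1}+b^{j-1})-\tau_s((a+1)b^{-1}+b^{j-1})\Big)\\&\quad+b^{s(\xi-1)}\Big(\tau_s(ab^{-1}+\eta_a)-\tau_s((a+1)b^{-1}+\eta_{a+1})\Big)+\eta_a-\eta_{a+1}.\end{aligned}$$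
   Context: A Pareto random variable with minimum value $x_{\mathrm m}$ and shape parameter $s$ has probability density function $f_X(x)=s\,x_{\mathrm m}^s\,x^{-(s+1)}$ for $x\ge x_{\mathrm m}$ (and $0$ otherwise). $\{z\}=z-\lfloor z\rfloor$ is the fractional part. The $j$-th integer significand of $X$ is $A_{(j)}=\lfloor b^{\{\log_b X\}+j-1}\rfloor\in\{b^{j-1},\ldots,b^j-1\}$, and the $j$-th most significant $b$-ary digit is $A_{[j]}=A_{(j)}\bmod b$. $\psi=\Gamma'/\Gamma$ is the digamma function. $\zeta(s,v)$ is Hurwitz's zeta function, equal to $\sum_{n=0}^\infty (n+v)^{-s}$ for $s>1$ and defined by analytic continuation in $s$ for $0<s<1$. *)

(* Defs.v *)
From HB Require Import structures.
From mathcomp Require Import all_boot all_order all_algebra complex.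
From mathcomp Require Import all_classical all_reals all_analysis.

Set Implicit Arguments.
Unset Strict Implicit.
Unset Printing Implicit Defensive.

Import Order.TTheory GRing.Theory Num.Theory.
Import numFieldNormedType.Exports.

Local Open Scope classical_set_scope.
Local Open Scope ring_scope.

Section digits.
Context {R : realType}.

Definition frac_part (z : R) : R := z - (Num.floor z)%:~R.

Definition logb (b : nat) (x : R) : R := ln x / ln (b%:R : R).

(* Only meaningful for x > 0: ln is 0 on nonpositive reals. *)
Definition significand (b j : nat) (x : R) : int :=
  Num.floor ((b%:R : R) `^ (frac_part (logb b x) + j%:R - 1)).

Definition digit (b j : nat) (x : R) : int := (significand b j x %% b%:Z)%Z.

End digits.

Section pareto.
Context {R : realType}.

Definition pareto_pdf (xm s : R) : R -> R :=
  (fun x => s * xm `^ s * x `^ (- (s + 1))) \_ `[xm, +oo[.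

Definition is_pareto (d : measure_display) (T : measurableType d) (P : probability T R)
    (X : {RV P >-> R}) (xm s : R) : Prop :=
  forall A : set R, measurable A ->
    distribution P X A =
    (\int[lebesgue_measure]_(x in A) (pareto_pdf xm s x)%:E)%E.

End pareto.

Section digamma.
Context {R : realType}.

Definition Gamma (x : R) : R :=
  \int[lebesgue_measure]_(t in `]0, +oo[) (t `^ (x - 1) * expR (- t)).

Definition digamma (x : R) : R := Gamma^`()%classic x / Gamma x.

End digamma.

Definition analytic_at (K : numFieldType) (f : K -> K) (z0 : K) : Prop :=
  exists c : nat -> K, \forall z \near z0,
    series (fun n => c n * (z - z0) ^+ n) @ \oo --> f z.

Section hurwitz.
Context {R : realType}.
Local Open Scope complex_scope.

Definition hurwitz_series (s v : R) : R :=
  limn (series (fun n => (n%:R + v) `^ (- s))).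

(* The real half-line s > 1 and the interval 0 < s < 1 are joined inside the
   connected open set {z : C | 0 < Re z, z <> 1}, on which the identity theorem
   makes f unique. *)
Definition is_hurwitz_continuation (v : R) (f : R[i] -> R[i]) : Prop :=
  (forall z : R[i], 0 < complex.Re z -> z <> 1 -> analytic_at f z) /\
  (forall s : R, 1 < s -> f s%:C = (hurwitz_series s v)%:C).

(* Intended for v > 0, s > 0 and s <> 1; the value is then a real number. *)
Definition hurwitz_zeta (s v : R) : R :=
  complex.Re (xget (fun=> 0) (is_hurwitz_continuation v) s%:C).

End hurwitz.

Definition tau {R : realType} (s v : R) : R :=
  if s == 1 then - digamma v else hurwitz_zeta s v.

(* Main.v *)
Require Import Defs.
From HB Require Import structures.
From mathcomp Require Import all_boot all_order all_algebra.
From mathcomp Require Import all_classical all_reals all_analysis.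
From mathcomp Require Import measurable_realfun complex ring lra zify.
Import Order.TTheory GRing.Theory Num.Theory.
Import numFieldNormedType.Exports.
Import ComplexField.Normc.
Local Open Scope classical_set_scope.
Local Open Scope ring_scope.

Set Implicit Arguments.
Unset Strict Implicit.
Unset Printing Implicit Defensive.

(** Put L = floor (log_b xm). The event that the j-th digit of X is a is the
    disjoint union, over the scales b^l <= X < b^(l+1) with l >= L and over the
    numbers k formed by j - 1 digits, of the events that X lies in the interval
    ([cell]) with bounds (b k + a) b^(l-j+1) and (b k + a + 1) b^(l-j+1). Each has
    as probability the difference of the values at its bounds of the survival
    function u |-> (xm / max (xm, u))^s ([pareto_prob_itv]). At the scales l > L
    all bounds exceed xm, so the survival function is a power, and the sum over k
    is one of terms (k + a/b)^(-s) - (k + (a+1)/b)^(-s). It telescopes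
    ([tau_sum]) because
      tau s v - tau s (v + 1) = v^(-s)     ([tau_shift]),
    and the sum over the scales is geometric with ratio b^(-s) ([bound_sumS]). At
    the scale L the survival function is 1 at the bounds below xm; these are the
    ones with k below eta, which explains the last terms of the formula
    ([bound_sum0]).

    The analytic content is [tau_shift]. For s = 1 it is the logarithmic
    derivative of Gamma (x + 1) = x Gamma x ([GammaD1]), once Gamma is known to be
    differentiable ([derivable_Gamma]).

    For s <> 1 the value of zeta is that of an analytic continuation, so its
    existence and uniqueness have to be proved. For v >= 1 and c > 1 expand at
    s = c, in powers of c - s, the function sum_n (n + v)^(-s) - 1 / (s - 1). On
    1 < s <= c all terms (ln x)^k x^(-c) (c - s)^k / k! are nonnegative, so sums may
    be exchanged ([hurwitz_series_expansion]), and the k-th coefficient is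
      a_k = sum_n p_k(n + v) - int_1^oo p_k,   p_k(x) = x^(-c) (ln x)^k / k!.
    Now c^k p_k(x) is the Poisson weight of k for the parameter c ln x, hence a
    difference of two nonincreasing functions of x with values in [0, 1], namely
    values of the Poisson distribution function. So p_k oscillates by at most
    2 c^(-k) in total, and comparing the sum with the integral gives |a_k| <= (v + 1) c^(-k) ([regular_coef_le]). The series
    thus converges on the disk of center c and radius c. These disks exhaust the
    half-plane Re s > 0; by the identity theorem ([analytic_zero_segment]) the sums
    agree on smaller disks, and with 1 / (s - 1) they make up the continuation
    ([continuationP]). The identity theorem along a path around the pole gives
    uniqueness ([hurwitz_continuation_unique]). Finally, a_k for v minus a_k for
    v + 1 is p_k(v), and these terms sum to v^(-s). *)

(** * Topology of the complex numbers *)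

(** Puts on the type R[i] itself the topology that every numFieldType has, so
    that limits and neighbourhoods in the complex plane can be written without
    casts. *)
#[non_forgetful_inheritance]
HB.instance Definition _ (R : realType) := NormedModule.copy R[i] (R[i])^o.

Section complex_topology.
Context {R : realType}.
Local Open Scope complex_scope.
Implicit Types (z w : R[i]) (r e : R).

Lemma normr_normc z : `|z| = (normc z)%:C.
Proof. by case: z. Qed.

Lemma normc_ge0 z : 0 <= normc z.
Proof. by case: z => x y; rewrite sqrtr_ge0. Qed.

Lemma normcX z n : normc (z ^+ n) = normc z ^+ n.
Proof.
elim: n => [|n IH]; first by rewrite !expr0 normc1.
by rewrite !exprS normcM IH.
Qed.

Lemma normcR r : normc r%:C = `|r|.
Proof. by rewrite /= expr0n addr0 sqrtr_sqr. Qed.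

Lemma normc_sum (I : Type) (s : seq I) (Q : pred I) (F : I -> R[i]) :
  normc (\sum_(i <- s | Q i) F i) <= \sum_(i <- s | Q i) normc (F i).
Proof.
elim/big_ind2 : _ => // [|x1 x2 y1 y2 h1 h2]; first by rewrite normc0.
by rewrite (le_trans (le_normcD _ _))// lerD.
Qed.

Lemma normc_distC z w : normc (z - w) = normc (w - z).
Proof. by rewrite -normcN opprB. Qed.

Lemma le_normc_dist z w t : normc (z - t) <= normc (z - w) + normc (w - t).
Proof. by rewrite -{1}(subrK w z) -addrA le_normcD. Qed.

Lemma near_normcP (z0 : R[i]) (Q : R[i] -> Prop) :
  (\forall z \near z0, Q z) <->
  exists2 r, 0 < r & forall z, normc (z - z0) < r -> Q z.
Proof.
split=> [/nbhs_ballP[e /= e0 eQ]|[r r0 rQ]].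
  move: e0 eQ; case: e => e f; rewrite ltcE /= => /andP[/eqP -> e0] eQ.
  exists e => // z ze; apply: eQ.
  by rewrite -ball_normE /ball_ /= normr_normc complexr0 ltcR normc_distC.
apply/nbhs_ballP; exists r%:C; first by rewrite /= ltcR.
move=> z; rewrite -ball_normE /ball_ /= normr_normc ltcR normc_distC.
exact: rQ.
Qed.

Lemma cvg_normcP (u : nat -> R[i]) (l : R[i]) :
  u @ \oo --> l <->
  forall e, 0 < e -> \forall n \near \oo, normc (u n - l) < e.
Proof.
split=> [/cvgrPdist_lt ul e e0|h].
  have := ul e%:C; rewrite ltcR => /(_ e0).
  by apply: filterS => n; rewrite normr_normc ltcR normc_distC.
apply/cvgrPdist_lt => -[e f]; rewrite ltcE /= => /andP[/eqP -> e0].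
apply: filterS (h e e0) => n.
by rewrite normr_normc complexr0 ltcR normc_distC.
Qed.

End complex_topology.

(** * Series of complex numbers *)

Section complex_series.
Context {R : realType}.
Local Open Scope complex_scope.
Implicit Types (u : nat -> R[i]) (z w l : R[i]) (r e : R).

Lemma series_Re u n : complex.Re (series u n) = series (fun k => complex.Re (u k)) n.
Proof.
rewrite /series /=; elim: n => [|n IH]; first by rewrite !big_geq.
by rewrite !big_nat_recr//= -IH; case: (\sum_(0 <= i < n) u i) => x y; case: (u n).
Qed.

Lemma series_Im u n : complex.Im (series u n) = series (fun k => complex.Im (u k)) n.
Proof.
rewrite /series /=; elim: n => [|n IH]; first by rewrite !big_geq.
by rewrite !big_nat_recr//= -IH; case: (\sum_(0 <= i < n) u i) => x y; case: (u n).
Qed.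

Lemma le_normcRe z : `|complex.Re z| <= normc z.
Proof. by have := normc_ge_Re z; rewrite normr_normc lecR. Qed.

Lemma le_normcIm z : `|complex.Im z| <= normc z.
Proof.
case: z => x y /=; rewrite -sqrtr_sqr ler_sqrt ?lerDr ?sqr_ge0//.
by rewrite addr_ge0 ?sqr_ge0.
Qed.

Lemma normc_le_ReIm z : normc z <= `|complex.Re z| + `|complex.Im z|.
Proof.
case: z => x y; have -> : (x +i* y) = (x%:C + (0 +i* y)).
  by rewrite /=; congr (_ +i* _); rewrite ?addr0 ?add0r.
rewrite (le_trans (le_normcD _ _))// normcR /= expr0n /= !add0r sqrtr_sqr addr0.
by rewrite lerD.
Qed.

Lemma cvg_complex u l :
  (fun n => complex.Re (u n)) @ \oo --> complex.Re l ->
  (fun n => complex.Im (u n)) @ \oo --> complex.Im l -> u @ \oo --> l.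
Proof.
move=> /cvgrPdist_lt h1 /cvgrPdist_lt h2; apply/cvg_normcP => e e0.
have e2 : 0 < e / 2 by rewrite divr_gt0.
apply: filterS2 (h1 _ e2) (h2 _ e2) => n a b.
rewrite normc_distC (le_lt_trans (normc_le_ReIm _))// [e]splitr.
by case: l {h1 h2} a b; case: (u n) => ? ? ? ? /= a b; rewrite ltrD.
Qed.

Lemma cvg_normc_le u l w r : u @ \oo --> l ->
  (\forall n \near \oo, normc (u n - w) <= r) -> normc (l - w) <= r.
Proof.
move=> /cvg_normcP ul ub; apply/ler_addgt0Pr => e e0.
near \oo => n.
rewrite (le_trans (le_normc_dist l (u n) w))// addrC lerD//.
  by near: n.
by rewrite normc_distC ltW//; near: n; exact: ul.
Unshelve. all: end_near. Qed.

Lemma complex_cvg_unique u l w : u @ \oo --> l -> u @ \oo --> w -> l = w.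
Proof.
move=> ul /cvg_normcP uw; apply/eqP; rewrite -subr_eq0; apply/eqP.
apply: eq0_normc; apply/eqP; rewrite eq_le normc_ge0 andbT.
apply/ler_addgt0Pr => e e0; rewrite add0r.
by apply: cvg_normc_le ul _; apply: filterS (uw e e0) => n /ltW.
Qed.

Definition abs_summable u := cvgn (series (fun n => normc (u n))).

Lemma series_le_lim (v : R ^nat) n : (forall k, 0 <= v k) ->
  cvgn (series v) -> series v n <= limn (series v).
Proof.
move=> v0 cv; apply: nondecreasing_cvgn_le cv n.
apply/nondecreasing_seqP => n; rewrite /series /= big_nat_recr//=.
by rewrite lerDl.
Qed.

Lemma abs_summable_cvg u : abs_summable u -> exists l : R[i], series u @ \oo --> l.
Proof.
move=> su.
have cRe : cvgn (series (fun n => complex.Re (u n))).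
  apply: normed_cvg; apply: (series_le_cvg _ _ _ su) => n //=.
  - exact: normc_ge0.
  - exact: le_normcRe.
have cIm : cvgn (series (fun n => complex.Im (u n))).
  apply: normed_cvg; apply: (series_le_cvg _ _ _ su) => n //=.
  - exact: normc_ge0.
  - exact: le_normcIm.
exists (limn (series (fun n => complex.Re (u n))) +i*
        limn (series (fun n => complex.Im (u n)))).
apply: cvg_complex => /=.
  by under eq_fun do rewrite series_Re.
by under eq_fun do rewrite series_Im.
Qed.

End complex_series.

(** * Re-expansion of power series *)

Section power_series.
Context {R : realType}.
Local Open Scope complex_scope.
Implicit Types (a c : nat -> R[i]) (f g : R[i] -> R[i]) (z w : R[i]) (r e : R).

Lemma exprDn_nat (S : comNzRingType) (x y : S) n :
  (x + y) ^+ n = \sum_(0 <= k < n.+1) x ^+ (n - k) * y ^+ k *+ 'C(n, k).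
Proof. by rewrite exprDn big_mkord. Qed.

Lemma cvg_sub_sum (F : numFieldType) (u : F ^nat) (B : nat -> F ^nat)
    (c b : nat -> F) (l : F) K :
  u @ \oo --> l -> (forall k, B k @ \oo --> b k) ->
  (fun n => u n - \sum_(0 <= k < K) B k n * c k) @ \oo -->
    l - \sum_(0 <= k < K) b k * c k.
Proof.
move=> ul Bb; apply: cvgB => //; apply: (cvg_big add_continuous) => k _.
by apply: cvgMr_tmp; exact: Bb.
Qed.

(** The remainder of order K of the binomial expansion; there is none when the
    exponent n is below K. *)
Lemma reexpand_term (w0 w : R[i]) (rho : R) (K n : nat) :
  normc w0 + normc w <= rho ->
  normc ((w0 + w) ^+ n - \sum_(0 <= k < K) w0 ^+ (n - k) * w ^+ k *+ 'C(n, k))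
  <= (K <= n)%:R * rho ^+ n.
Proof.
move=> le_rho; rewrite exprDn_nat.
have [Kn|nK] := leqP K n; last first.
  rewrite mul0r (@big_cat_nat _ _ _ n.+1 0 K)//= [X in _ - (_ + X)]big1_seq.
    by rewrite addr0 subrr normc0.
  move=> k; rewrite mem_index_iota => /andP[_ /andP[nk _]].
  by rewrite bin_small.
rewrite mul1r (@big_cat_nat _ _ _ K 0 n.+1)//= ?leqW// addrAC subrr add0r.
have rho_ge : (normc w0 + normc w) ^+ n <= rho ^+ n.
  by rewrite lerXn2r// nnegrE ?addr_ge0 ?normc_ge0// (le_trans _ le_rho)//
    addr_ge0 ?normc_ge0.
rewrite (le_trans (normc_sum _ _ _))// (le_trans _ rho_ge)// exprDn_nat.
rewrite [X in _ <= X](@big_cat_nat _ _ _ K 0 n.+1)//= ?leqW//.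
rewrite ler_wpDl//.
  by rewrite sumr_ge0// => k _; rewrite mulrn_wge0// mulr_ge0// exprn_ge0 ?normc_ge0.
apply: ler_sum => k _.
by rewrite normcMn normcM !normcX.
Qed.

Lemma normc_bin_le (w0 : R[i]) (rho : R) (k n : nat) : normc w0 < rho ->
  normc (w0 ^+ (n - k) *+ 'C(n, k)) * (rho - normc w0) ^+ k <= rho ^+ n.
Proof.
move=> w0rho; have [nk|kn] := ltnP n k.
  rewrite bin_small// mulr0n normc0 mul0r exprn_ge0//.
  by rewrite (le_trans _ (ltW w0rho))// normc_ge0.
rewrite -{2}(subrK (normc w0) rho) [X in _ <= X ^+ _]addrC [X in _ <= X]exprDn.
rewrite (bigD1 (Ordinal (kn : k < n.+1)%N))//= normcMn normcX mulrnAl.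
rewrite lerDl sumr_ge0// => i _; rewrite mulrn_wge0// mulr_ge0// exprn_ge0//.
  exact: normc_ge0.
by rewrite subr_ge0 ltW.
Qed.

(** A power series can be expanded again around any point w0 of its disk.
    Truncating the new series at order K leaves, in the partial sums of the old
    series, only terms of index at least K, each bounded by the term of the
    majorant series at radius rho: so the remainders of the majorant bound those
    of the new series. *)
Lemma power_series_reexpand a (w0 : R[i]) (rho : R) : normc w0 < rho ->
  cvgn (series (fun n => normc (a n) * rho ^+ n)) ->
  exists b : nat -> R[i], forall w (l : R[i]), normc w < rho - normc w0 ->
    series (fun n => a n * (w0 + w) ^+ n) @ \oo --> l ->
    series (fun n => b n * w ^+ n) @ \oo --> l.
Proof.
move=> w0rho ca; set T := limn (series (fun n => normc (a n) * rho ^+ n)).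
have rho0 : 0 <= rho by rewrite (le_trans _ (ltW w0rho))// normc_ge0.
pose B k n := a n * (w0 ^+ (n - k) *+ 'C(n, k)).
have sB k : abs_summable (B k).
  set d := (rho - normc w0) ^+ k.
  have d0 : 0 < d by rewrite exprn_gt0// subr_gt0.
  have cd : cvgn (series (fun n => d^-1 * (normc (a n) * rho ^+ n))).
    by have := @is_cvg_seriesZ _ _ d^-1 ca.
  apply: (series_le_cvg _ _ _ cd) => n.
  - exact: normc_ge0.
  - by rewrite mulr_ge0 ?invr_ge0 ?(ltW d0)// mulr_ge0 ?normc_ge0 ?exprn_ge0.
  - rewrite normcM mulrCA ler_wpM2l ?normc_ge0// ler_pdivlMl// mulrC.
    exact: normc_bin_le.
pose b k := projT1 (cid (abs_summable_cvg (sB k))).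
have bP k : series (B k) @ \oo --> b k by rewrite /b; case: cid.
exists b => w l wr al.
have step K : normc (l - series (fun k => b k * w ^+ k) K) <=
    T - series (fun n => normc (a n) * rho ^+ n) K.
  have cK : (fun n => series (fun k => a k * (w0 + w) ^+ k) n -
                      \sum_(0 <= k < K) series (B k) n * w ^+ k) @ \oo -->
           l - series (fun k => b k * w ^+ k) K.
    exact: cvg_sub_sum.
  rewrite -[X in normc X]subr0; apply: cvg_normc_le cK _.
  near=> n; rewrite subr0.
  have Kn : (K <= n)%N by near: n; exact: nbhs_infty_ge.
  have -> : series (fun k => a k * (w0 + w) ^+ k) n -
      \sum_(0 <= k < K) series (B k) n * w ^+ k =
      \sum_(0 <= i < n) a i * ((w0 + w) ^+ i -
         \sum_(0 <= k < K) w0 ^+ (i - k) * w ^+ k *+ 'C(i, k)).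
    under [X in _ - X]eq_bigr do rewrite /series /= mulr_suml.
    rewrite exchange_big /= -sumrB; apply: eq_bigr => i _.
    rewrite mulrBr; congr (_ - _); rewrite mulr_sumr; apply: eq_bigr => k _.
    by rewrite /B -mulrA mulrnAl.
  rewrite (le_trans (normc_sum _ _ _))//.
  have : series (fun n => normc (a n) * rho ^+ n) n -
         series (fun n => normc (a n) * rho ^+ n) K <=
         T - series (fun n => normc (a n) * rho ^+ n) K.
    rewrite lerD2r series_le_lim// => k.
    by rewrite mulr_ge0 ?normc_ge0 ?exprn_ge0.
  apply: le_trans; rewrite /series /=.
  rewrite [X in _ <= X - _](big_cat_nat (n := K))//= [X in _ <= X]addrAC subrr add0r.
  rewrite (big_cat_nat (n := K))//= [X in X + _]big1_seq ?add0r.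
    apply: ler_sum_nat => i /andP[Ki _].
    rewrite normcM ler_wpM2l ?normc_ge0// (le_trans (reexpand_term _ _ (rho := rho) _))//.
      by rewrite -lerBrDl ltW.
    by rewrite Ki mul1r.
  move=> i; rewrite mem_index_iota => /andP[_ /andP[_ iK]].
  have := @reexpand_term w0 w rho K i.
  rewrite leqNgt iK mul0r -lerBrDl ltW// => /(_ isT) h.
  rewrite normcM; apply/eqP; rewrite mulf_eq0; apply/orP; right.
  by rewrite eq_le h normc_ge0.
apply/cvg_normcP => e e0.
have /cvgrPdist_lt/(_ _ e0) := ca.
apply: filterS => n; rewrite normc_distC; apply: le_lt_trans.
by rewrite (le_trans (step n))// ler_norm.
Unshelve. all: end_near. Qed.

End power_series.

(** * Analytic functions and the identity theorem *)

Section identity_theorem.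
Context {R : realType}.
Local Open Scope complex_scope.
Implicit Types (a c : nat -> R[i]) (f g : R[i] -> R[i]) (z w : R[i]) (r e : R).

Lemma analytic_at_power_series a (c z0 : R[i]) (rho : R) f :
  normc (z0 - c) < rho ->
  cvgn (series (fun n => normc (a n) * rho ^+ n)) ->
  (forall z, normc (z - c) < rho ->
    series (fun n => a n * (z - c) ^+ n) @ \oo --> f z) ->
  analytic_at f z0.
Proof.
move=> z0rho ca af; have [b bP] := power_series_reexpand z0rho ca.
exists b; apply/near_normcP; exists (rho - normc (z0 - c)).
  by rewrite subr_gt0.
move=> z zz0; apply: bP => //.
have -> : z0 - c + (z - z0) = z - c by rewrite addrC addrA subrK.
apply: af; rewrite (le_lt_trans (le_normc_dist z z0 c))//.
by rewrite -ltrBrDr.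
Qed.

Lemma analytic_atB f g z0 : analytic_at f z0 -> analytic_at g z0 ->
  analytic_at (fun z => f z - g z) z0.
Proof.
move=> [a fa] [b gb]; exists (fun n => a n - b n).
apply: filterS2 fa gb => z fz gz.
have -> : series (fun n => (a n - b n) * (z - z0) ^+ n) =
  fun n => series (fun n => a n * (z - z0) ^+ n) n -
           series (fun n => b n * (z - z0) ^+ n) n.
  apply/funext => n; rewrite /series /= -sumrB.
  by apply: eq_bigr => i _; rewrite mulrBl.
exact: cvgB fz gz.
Qed.

Lemma analytic_atD f g z0 : analytic_at f z0 -> analytic_at g z0 ->
  analytic_at (fun z => f z + g z) z0.
Proof.
move=> [a fa] [b gb]; exists (fun n => a n + b n).
apply: filterS2 fa gb => z fz gz.
have -> : series (fun n => (a n + b n) * (z - z0) ^+ n) =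
  fun n => series (fun n => a n * (z - z0) ^+ n) n +
           series (fun n => b n * (z - z0) ^+ n) n.
  apply/funext => n; rewrite /series /= -big_split.
  by apply: eq_bigr => i _; rewrite mulrDl.
exact: cvgD fz gz.
Qed.

Lemma analytic_at_near f g z0 : (\forall z \near z0, f z = g z) ->
  analytic_at f z0 -> analytic_at g z0.
Proof.
move=> fg [a fa]; exists a; apply: filterS2 fg fa => z <-; exact.
Qed.

(** The geometric series around z0 has ratio of modulus below 1 on the largest
    disk that avoids the pole. *)
Lemma analytic_at_inv (c z0 : R[i]) : z0 <> c -> analytic_at (fun z => (z - c)^-1) z0.
Proof.
move=> /eqP; rewrite -subr_eq0; set d := z0 - c => d0.
have nd0 : 0 < normc d.
  by rewrite lt_neqAle normc_ge0 andbT eq_sym; apply: contra d0 => /eqP/eq0_normc/eqP.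
exists (fun n => d^-1 * (- d^-1) ^+ n); apply/near_normcP; exists (normc d) => // z.
set w := z - z0 => wd; set q : R[i] := - d^-1 * w.
have zc : z - c = d + w by rewrite /d /w [RHS]addrC addrA subrK.
have q1 : normc q < 1.
  by rewrite normcM normcN normcV mulrC ltr_pdivrMr// mul1r.
have q_neq1 : 1 - q != 0.
  rewrite subr_eq0 eq_sym; apply/eqP => q1'; move: q1.
  by rewrite q1' normc1 ltxx.
have zq : z - c = d * (1 - q).
  by rewrite zc mulrBr mulr1 /q mulrA mulrN divff// mulN1r opprK.
apply/cvg_normcP => e e0.
have e0' : 0 < e * normc (z - c).
  rewrite mulr_gt0// zq normcM mulr_gt0// lt_neqAle normc_ge0 andbT eq_sym.
  by apply: contra q_neq1 => /eqP/eq0_normc/eqP.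
have : (fun n => normc q ^+ n) @ \oo --> (0 : R).
  by apply: cvg_expr; rewrite ger0_norm ?normc_ge0.
move=> /cvgrPdist_lt/(_ _ e0'); apply: filterS => n.
rewrite sub0r normrN ger0_norm ?exprn_ge0 ?normc_ge0// => qn.
have -> : series (fun n => d^-1 * (- d^-1) ^+ n * w ^+ n) n = (z - c)^-1 * (1 - q ^+ n).
  rewrite /series /=; under eq_bigr do rewrite -mulrA -exprMn -/q.
  rewrite -mulr_sumr zq invfM -mulrA; congr (_ * _).
  apply: (mulfI q_neq1); rewrite mulrA divff// mul1r.
  by rewrite -opprB mulNr -[RHS]opprB subrX1 big_mkord.
rewrite mulrBr mulr1 addrAC subrr add0r normcN normcM normcV normcX.
rewrite mulrC ltr_pdivrMr//.
by rewrite zq normcM mulr_gt0// lt_neqAle normc_ge0 andbT eq_sym;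
  apply: contra q_neq1 => /eqP/eq0_normc/eqP.
Qed.

Lemma geometric_tail_le (q : R) (m n : nat) : 0 <= q <= 1 / 2 ->
  \sum_(m <= k < n) q ^+ k <= 2 * q ^+ m.
Proof.
move=> /andP[q0 q2]; have [nm|mn] := leqP n m.
  by rewrite big_geq// mulr_ge0// exprn_ge0.
suff : \sum_(m <= k < n) q ^+ k + 2 * q ^+ n <= 2 * q ^+ m.
  by apply: le_trans; rewrite lerDl mulr_ge0// exprn_ge0.
elim: n mn => // n IH; rewrite ltnS leq_eqVlt => /predU1P[<-|mn].
  rewrite big_nat1 exprS; have := exprn_ge0 m q0; move: (q ^+ m) => x x0; nra.
rewrite big_nat_recr ?(ltnW mn)//= (le_trans _ (IH mn))// -addrA lerD2l exprS.
by have := exprn_ge0 n q0; move: (q ^+ n) => x x0; nra.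
Qed.

Lemma power_series_coef_bounded c (r : R) : 0 <= r ->
  cvgn (series (fun n => c n * r%:C ^+ n)) ->
  exists2 M, 0 < M & forall n, normc (c n) * r ^+ n <= M.
Proof.
move=> r0 /cvg_series_cvg_0/cvg_normcP h.
have : (fun n => normc (c n) * r ^+ n) @ \oo --> (0 : R).
  apply/cvgrPdist_lt => e e0; apply: filterS (h e e0) => n.
  rewrite subr0 normcM normcX normcR (ger0_norm r0) sub0r normrN.
  by rewrite ger0_norm// mulr_ge0 ?normc_ge0 ?exprn_ge0.
move=> /cvgP/cvg_seq_bounded[M [_ /(_ (`|M| + 1))]].
rewrite (le_lt_trans (ler_norm M)) ?ltrDl// => /(_ isT) Mb.
exists (`|M| + 1) => [|n]; first by rewrite ltr_wpDl.
by rewrite (le_trans (ler_norm _))//; exact: Mb.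
Qed.

(** If the coefficients of index below m vanish, the m-th one is the value of
    the function divided by (z - z0)^m, up to an error of order |z - z0|; at a
    zero close to z0 this forces it to be small. *)
Lemma leading_coef_le c (w : R[i]) (M d : R) m :
  0 < d -> 0 < normc w -> normc w <= d / 2 ->
  (forall n, normc (c n) * d ^+ n <= M) -> (forall k, (k < m)%N -> c k = 0) ->
  series (fun n => c n * w ^+ n) @ \oo --> (0 : R[i]) ->
  normc (c m) <= 2 * M / d ^+ m.+1 * normc w.
Proof.
move=> d0 w0 wd Mc c0 cw; set q := normc w / d.
have q0 : 0 <= q by rewrite divr_ge0 ?normc_ge0// ltW.
have q2 : q <= 1 / 2 by rewrite ler_pdivrMr// mulrC div1r.
have term n : normc (c n * w ^+ n) <= M * q ^+ n.
  have -> : normc (c n * w ^+ n) = (normc (c n) * d ^+ n) * q ^+ n.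
    by rewrite normcM normcX -mulrA -exprMn /q mulrCA divff ?mulr1// gt_eqF.
  by rewrite ler_wpM2r// exprn_ge0.
have M0 : 0 <= M by rewrite (le_trans _ (Mc 0%N))// mulr_ge0 ?normc_ge0 ?exprn_ge0 ?ltW.
have le_m : normc (0 - c m * w ^+ m) <= M * (2 * q ^+ m.+1).
  apply: cvg_normc_le cw _; near=> n.
  have mn : (m < n)%N by near: n; exact: nbhs_infty_gt.
  rewrite /series /= (big_cat_nat (n := m.+1))//= big_nat_recr//= big1_seq; last first.
    move=> i; rewrite mem_index_iota => /andP[_ /andP[_ im]].
    by rewrite c0// mul0r.
  rewrite add0r addrAC subrr add0r (le_trans (normc_sum _ _ _))//.
  rewrite (@le_trans _ _ (\sum_(m.+1 <= i < n) M * q ^+ i))//.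
    by apply: ler_sum => i _; exact: term.
  by rewrite -mulr_sumr ler_wpM2l// geometric_tail_le// q0.
move: le_m; rewrite sub0r normcN normcM normcX => h.
have wm : 0 < normc w ^+ m by rewrite exprn_gt0.
rewrite -(ler_pM2r wm) (le_trans h)// /q expr_div_n exprS.
by rewrite le_eqVlt; apply/orP; left; apply/eqP; rewrite exprS; field;
  rewrite ?expf_neq0 ?gt_eqF.
Unshelve. all: end_near. Qed.

(** The coefficients vanish one after the other: zeros arbitrarily close to z0
    make the bound of [leading_coef_le] arbitrarily small. *)
Lemma analytic_zero f z0 : analytic_at f z0 ->
  (forall e, 0 < e -> exists z, [/\ 0 < normc (z - z0), normc (z - z0) < e & f z = 0]) ->
  \forall z \near z0, f z = 0.
Proof.
move=> [c /near_normcP[r r0 rc]] fz.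
set d := r / 2; have d0 : 0 < d by rewrite divr_gt0.
have dr : d < r by rewrite ltr_pdivrMr// ltr_pMr// ltr1n.
have [M M0 cM] : exists2 M, 0 < M & forall n, normc (c n) * d ^+ n <= M.
  apply: power_series_coef_bounded; first exact: ltW.
  have := rc (z0 + d%:C); rewrite addrAC subrr add0r normcR gtr0_norm// => /(_ dr).
  exact: cvgP.
have c0 m : c m = 0.
  have [n] := ubnP m; elim: n m => // n IH m; rewrite ltnS => mn.
  apply: eq0_normc; apply/eqP; rewrite eq_le normc_ge0 andbT.
  apply/ler_addgt0Pr => e e0; rewrite add0r.
  set K := 2 * M / d ^+ m.+1.
  have K0 : 0 < K by rewrite divr_gt0 ?exprn_gt0 ?mulr_gt0.
  have m0 : 0 < Num.min (d / 2) (e / K) by rewrite lt_min; apply/andP; split; apply: divr_gt0.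
  have [z [zz0 zmin fz0]] := fz _ m0.
  move: zmin; rewrite lt_min => /andP[zd ze].
  apply: (le_trans (leading_coef_le d0 zz0 (ltW zd) cM _ _)).
  - by move=> k km; apply: IH; exact: leq_trans mn.
  - rewrite -fz0; apply: rc; rewrite (lt_trans zd)// (lt_trans _ dr)//.
    by rewrite ltr_pdivrMr// ltr_pMr// ltr1n.
  - by rewrite mulrC -ler_pdivlMr// ltW.
apply/near_normcP; exists r => // z /rc fzc.
apply: complex_cvg_unique fzc _.
rewrite (_ : series _ = cst 0); first exact: cvg_cst.
by apply/funext => n; rewrite /series /= big1// => i _; rewrite c0 mul0r.
Qed.

(** The set of parameters up to which the function vanishes near the segment
    contains its supremum, as zeros accumulate there, and does not stop there. *)
Lemma analytic_zero_segment f (p q : R[i]) :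
  (forall t : R, 0 <= t <= 1 -> analytic_at f (p + t%:C * (q - p))) ->
  (\forall z \near p, f z = 0) -> \forall z \near q, f z = 0.
Proof.
move=> fan fp.
have [<-//|pq] := eqVneq p q.
set D := normc (q - p).
have D0 : 0 < D.
  rewrite lt_neqAle normc_ge0 andbT eq_sym; apply/negP => /eqP/eq0_normc/eqP.
  by rewrite subr_eq0 eq_sym (negbTE pq).
pose g (t : R) := p + t%:C * (q - p).
have gdist t u : normc (g t - g u) = `|t - u| * D.
  rewrite /g opprD addrACA subrr add0r -mulrBl normcM.
  by rewrite -rmorphB normcR.
clearbody D.
pose Z t := \forall z \near g t, f z = 0.
pose E := [set t : R | 0 <= t <= 1 /\ forall u, 0 <= u <= t -> Z u].
have Zopen t : Z t -> exists2 r : R, 0 < r & forall u : R, `|u - t| < r -> Z u.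
  move=> /near_normcP[r r0 rf]; exists (r / D); first exact: divr_gt0.
  move=> u ut; have {}ut : normc (g u - g t) < r by rewrite gdist -ltr_pdivlMr.
  apply/near_normcP; exists (r - normc (g u - g t)); first by rewrite subr_gt0.
  move=> z; rewrite ltrBrDr => zr; apply: rf.
  exact: le_lt_trans (le_normc_dist z (g u) (g t)) zr.
have E0 : E 0.
  split=> [|u]; first by rewrite lexx ler01.
  by rewrite -eq_le => /eqP <-; rewrite /Z /g rmorph0 mul0r addr0.
have supE : has_sup E.
  by split; [exists 0|exists 1 => t [/andP[]]].
set tau := sup E.
have tau01 : 0 <= tau <= 1.
  apply/andP; split; first exact: ub_le_sup supE.2 _ E0.
  by apply: ge_sup; [exists 0|move=> t [/andP[]]].
have Zlt u : 0 <= u -> u < tau -> Z u.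
  move=> u0 /(sup_gt supE.1)[t [_ tZ] ut]; apply: tZ.
  by rewrite u0 ltW.
have Ztau : Z tau.
  have [[_]|nE] := pselect (E tau); first by apply; rewrite lexx; case/andP: tau01 => ->.
  apply: analytic_zero; first exact: fan.
  move=> e e0.
  have : tau - e / D < tau by rewrite ltrBlDr ltrDl divr_gt0.
  move=> /(sup_gt supE.1)[t Et te].
  have ttau : t < tau.
    rewrite lt_neqAle ub_le_sup//; last exact: supE.2.
    by rewrite andbT; apply/eqP => ttau; apply: nE; rewrite -ttau.
  exists (g t); rewrite gdist ltr0_norm ?subr_lt0// opprB; split.
  - by rewrite mulr_gt0// subr_gt0.
  - by rewrite -ltr_pdivlMr// ltrBlDr -ltrBlDl.
  - by apply: (@nbhs_singleton _ (g t) (fun z => f z = 0)); apply: Et.2; rewrite lexx;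
      case/andP: Et.1 => ->.
have [tau1|tau1] := eqVneq tau 1.
  by move: Ztau; rewrite tau1 /Z /g rmorph1 mul1r addrC subrK.
have {}tau1 : tau < 1 by rewrite lt_neqAle tau1; case/andP: tau01.
have [r r0 rZ] := Zopen _ Ztau.
pose t := Num.min 1 (tau + r / 2).
have taut : tau < t by rewrite lt_min tau1 ltrDl divr_gt0.
exfalso; suff Et : E t.
  by have := ub_le_sup supE.2 Et; rewrite -/tau leNgt taut.
split.
  by rewrite (le_trans _ (ltW taut)) ?ge_min ?lexx//; case/andP: tau01.
move=> u /andP[u0 ut]; have [|tauu] := ltP u tau; first exact: Zlt.
apply: rZ; rewrite ger0_norm ?subr_ge0 ?tauu// ltrBlDl.
move: ut; rewrite le_min => /andP[_ /le_lt_trans]; apply.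
by rewrite ltrD2l ltr_pdivrMr// ltr_pMr// ltr1n.
Qed.

End identity_theorem.

(** * Poisson weights *)

Section poisson.
Context {R : realType}.
Implicit Types (x y c v : R) (k n : nat).

Lemma fact_neq0 k : k`!%:R != 0 :> R.
Proof. by rewrite pnatr_eq0 -lt0n fact_gt0. Qed.

Definition poisson_pmf k y : R := expR (- y) * (y ^+ k / k`!%:R).

Definition poisson_cdf k y : R := \sum_(0 <= i < k) poisson_pmf i y.

Lemma poisson_pmf_ge0 k y : 0 <= y -> 0 <= poisson_pmf k y.
Proof. by move=> y0; rewrite mulr_ge0 ?expR_ge0// divr_ge0// exprn_ge0. Qed.

Lemma poisson_cdfS k y : poisson_cdf k.+1 y = poisson_cdf k y + poisson_pmf k y.
Proof. by rewrite /poisson_cdf big_nat_recr. Qed.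

Lemma poisson_cdf_ge0 k y : 0 <= y -> 0 <= poisson_cdf k y.
Proof. by move=> y0; rewrite sumr_ge0// => i _; exact: poisson_pmf_ge0. Qed.

Lemma poisson_cdf_at0 k : poisson_cdf k.+1 0 = 1.
Proof.
rewrite /poisson_cdf big_nat_recl//= big1 => [|i _].
  by rewrite addr0 /poisson_pmf oppr0 expR0 mul1r expr0 fact0 divr1.
by rewrite /poisson_pmf exprS !mul0r mulr0.
Qed.

Lemma is_derive_poisson_pmf0 y :
  is_derive y 1 (poisson_pmf 0) (- poisson_pmf 0 y).
Proof.
have -> : poisson_pmf 0 = (fun y => expR (- y)).
  by apply/funext => z; rewrite /poisson_pmf expr0 fact0 divr1 mulr1.
by apply: is_derive_eq; rewrite mulrN1.
Qed.

Lemma is_derive_poisson_pmf k y :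
  is_derive y 1 (poisson_pmf k.+1) (poisson_pmf k y - poisson_pmf k.+1 y).
Proof.
have -> : poisson_pmf k.+1 =
    (fun y => expR (- y)) * ((k.+1)`!%:R^-1 *: (@id R) ^+ k.+1).
  by apply/funext => z; rewrite /poisson_pmf !fctE /= /GRing.scale /= [_ / _]mulrC.
apply: is_derive_eq; rewrite !fctE /= /GRing.scale /= /poisson_pmf factS natrM.
by field; rewrite fact_neq0 addrC natr1 pnatr_eq0.
Qed.

Lemma is_derive_poisson_cdf k y :
  is_derive y 1 (poisson_cdf k.+1) (- poisson_pmf k y).
Proof.
elim: k => [|k IH].
  have -> : poisson_cdf 1 = poisson_pmf 0.
    by apply/funext => z; rewrite /poisson_cdf big_nat1.
  exact: is_derive_poisson_pmf0.
have -> : poisson_cdf k.+2 = poisson_cdf k.+1 + poisson_pmf k.+1.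
  by apply/funext => z; rewrite poisson_cdfS.
have h := is_derive_poisson_pmf k y.
by apply: is_derive_eq; rewrite addrA addNr add0r.
Qed.

Lemma poisson_cdf_nincr k x y : 0 <= x -> x <= y ->
  poisson_cdf k y <= poisson_cdf k x.
Proof.
case: k => [|k x0]; first by rewrite /poisson_cdf !big_geq.
apply: (@ler0_derive1_nincry _ _ 0) => // [z _|z z0|].
- by have [] := is_derive_poisson_cdf k z.
- have h := is_derive_poisson_cdf k z; rewrite derive1E derive_val oppr_le0.
  by apply: poisson_pmf_ge0; move: z0; rewrite in_itv /= andbT => /ltW.
- apply: derivable_within_continuous => z _.
  by have [] := is_derive_poisson_cdf k z.
Qed.

Lemma poisson_cdf_le1 k y : 0 <= y -> poisson_cdf k y <= 1.
Proof.
move=> y0; case: k => [|k]; first by rewrite /poisson_cdf big_geq.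
by rewrite -(poisson_cdf_at0 k); exact: poisson_cdf_nincr.
Qed.

Lemma poisson_pmf_le1 k y : 0 <= y -> poisson_pmf k y <= 1.
Proof.
move=> y0; apply: le_trans (poisson_cdf_le1 k.+1 y0).
by rewrite poisson_cdfS lerDr poisson_cdf_ge0.
Qed.

(** y times the i-th mass is i + 1 times the next one, hence at most k for
    i < k. *)
Lemma poisson_cdf_le k y : 0 < y -> poisson_cdf k y <= (k * k)%:R / y.
Proof.
move=> y0; rewrite ler_pdivlMr// /poisson_cdf mulr_suml.
apply: (@le_trans _ _ (\sum_(0 <= i < k) k%:R)).
  apply: ler_sum_nat => i /andP[_ ik].
  have -> : poisson_pmf i y * y = i.+1%:R * poisson_pmf i.+1 y.
    rewrite /poisson_pmf factS natrM exprSr; field.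
    by rewrite fact_neq0 addrC natr1 pnatr_eq0.
  rewrite (@le_trans _ _ i.+1%:R)//; last by rewrite ler_nat.
  by rewrite ler_piMr// poisson_pmf_le1// ltW.
by rewrite sumr_const_nat subn0 natrM mulr_natr.
Qed.

End poisson.

(** * Sums of logarithmic powers *)

Section log_power_sums.
Context {R : realType}.
Implicit Types (x y c v s : R) (k n N : nat).

Lemma lim_series_recl (u : R ^nat) : cvgn (series (fun n => u n.+1)) ->
  limn (series u) = u 0%N + limn (series (fun n => u n.+1)).
Proof.
move=> cu; apply: cvg_lim => //; rewrite -(cvg_shiftn 1).
have -> : (fun n => series u (n + 1)%N) =
    (fun n => u 0%N + series (fun n => u n.+1) n).
  by apply/funext => n; rewrite addn1 /series /= big_nat_recl.
by apply: cvgD => //; exact: cvg_cst.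
Qed.

(** Up to sign, the k-th Taylor coefficient of s |-> x^(-s) at s = c. *)
Definition logpow c k x : R := x `^ (- c) * (ln x ^+ k / k`!%:R).

Lemma logpowE c k x : 0 < c -> 0 < x ->
  logpow c k x = c ^- k * poisson_pmf k (c * ln x).
Proof.
move=> c0 x0; rewrite /logpow /poisson_pmf /powR gt_eqF// exprMn mulNr.
by field; rewrite fact_neq0 expf_neq0// gt_eqF.
Qed.

Lemma logpow_ge0 c k x : 1 <= x -> 0 <= logpow c k x.
Proof.
by move=> x1; rewrite mulr_ge0 ?powR_ge0// divr_ge0// exprn_ge0// ln_ge0.
Qed.

(** The integral of [logpow c k] from x to infinity, in closed form. *)
Definition logpow_tail c k x : R :=
  (c - 1) ^- k.+1 * poisson_cdf k.+1 ((c - 1) * ln x).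

Lemma is_derive_logpow_tail c k x : 1 < c -> 0 < x ->
  is_derive x 1 (logpow_tail c k) (- logpow c k x).
Proof.
move=> c1 x0; set d := c - 1; have d0 : 0 < d by rewrite subr_gt0.
have -> : logpow_tail c k =
    d ^- k.+1 *: (poisson_cdf k.+1 \o (d *: (@ln R))) by [].
have h := is_derive1_ln x0.
have h2 := is_derive_poisson_cdf k (d * ln x).
apply: is_derive_eq; rewrite /GRing.scale /= !mulNr mulrN; congr (- _).
have -> : logpow c k x = x^-1 * logpow d k x.
  rewrite /logpow [RHS]mulrA; congr (_ * _); rewrite /powR gt_eqF// /d opprB.
  by rewrite mulNr expRN mulrBl mul1r expRB lnK// mulrA mulVf ?mul1r ?gt_eqF.
rewrite logpowE// exprSr; field.
by rewrite !gt_eqF// exprn_gt0.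
Qed.

(** The integrand [logpow c k] is, up to the factor c^(-k), a difference of two
    nonincreasing functions with values in [0, 1]; this is their sum, which
    controls its oscillation. *)
Definition logpow_osc c k x : R :=
  poisson_cdf k.+1 (c * ln x) + poisson_cdf k (c * ln x).

Lemma logpow_osc_ge0 c k x : 0 < c -> 1 <= x -> 0 <= logpow_osc c k x.
Proof.
by move=> c0 x1; rewrite addr_ge0// poisson_cdf_ge0// mulr_ge0 ?ln_ge0// ltW.
Qed.

Lemma logpow_osc_le2 c k x : 0 < c -> 1 <= x -> logpow_osc c k x <= 2.
Proof.
move=> c0 x1; rewrite -[2]/(1 + 1 : R) lerD// poisson_cdf_le1// mulr_ge0 ?ln_ge0//;
  exact: ltW.
Qed.

Lemma logpow_dist_le c k x y z : 0 < c -> 1 <= x -> x <= y -> y <= z ->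
  `|logpow c k y - logpow c k x| <=
  c ^- k * (logpow_osc c k x - logpow_osc c k z).
Proof.
move=> c0 x1 xy yz.
have x0 : 0 < x by exact: lt_le_trans x1.
have y0 : 0 < y by exact: lt_le_trans xy.
have z0 : 0 < z by exact: lt_le_trans yz.
rewrite !logpowE// -mulrBr normrM gtr0_norm ?invr_gt0 ?exprn_gt0//.
rewrite ler_pM2l ?invr_gt0 ?exprn_gt0//.
have lx0 : 0 <= c * ln x by rewrite mulr_ge0 ?ln_ge0// ltW.
have lxy : c * ln x <= c * ln y by rewrite ler_pM2l// ler_ln.
have lyz : c * ln y <= c * ln z by rewrite ler_pM2l// ler_ln.
have ly0 := le_trans lx0 lxy.
rewrite /logpow_osc.
have := poisson_cdf_nincr k.+1 lx0 lxy; have := poisson_cdf_nincr k lx0 lxy.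
have := poisson_cdf_nincr k.+1 ly0 lyz; have := poisson_cdf_nincr k ly0 lyz.
rewrite !poisson_cdfS ler_norml; move: (poisson_cdf k _) (poisson_cdf k _)
 (poisson_cdf k _) (poisson_pmf k _) (poisson_pmf k _) (poisson_pmf k _).
by move=> *; apply/andP; split; lra.
Qed.

Lemma logpow_tail_MVT c k x y : 1 < c -> 0 < x -> x < y ->
  exists2 z, x < z < y &
    logpow_tail c k x - logpow_tail c k y = logpow c k z * (y - x).
Proof.
move=> c1 x0 xy.
have der z : z \in `]x, y[ -> is_derive z 1 (logpow_tail c k) (- logpow c k z).
  rewrite in_itv /= => /andP[xz _]; apply: is_derive_logpow_tail => //.
  exact: lt_trans xz.
have [|z] := MVT xy der.
  apply: derivable_within_continuous => z; rewrite in_itv /= => /andP[xz _].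
  by have [] := is_derive_logpow_tail k c1 (lt_le_trans x0 xz).
rewrite in_itv /= => xzy h; exists z => //.
by rewrite -[LHS]opprB h mulNr opprK.
Qed.

(** By the mean value theorem the integral over [n + v, n + 1 + v] is a value of
    the integrand, which differs from the value at n + v by at most the decrease
    of [logpow_osc]; these decreases telescope. *)
Lemma logpow_sum_dist c v k N : 1 < c -> 1 <= v ->
  `|\sum_(0 <= n < N) logpow c k (n%:R + v) -
    (logpow_tail c k v - logpow_tail c k (N%:R + v))| <=
  c ^- k * (logpow_osc c k v - logpow_osc c k (N%:R + v)).
Proof.
move=> c1 v1; have c0 : 0 < c by exact: lt_trans c1.
elim: N => [|N IH].
  by rewrite big_geq// (add0r v) !subrr normr0 mulr0.
have N1 : 1 <= N%:R + v by rewrite ler_wpDl.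
have NS : N%:R + v < N.+1%:R + v by rewrite ltrD2r ltr_nat.
have [z /andP[Nz zN] tailE] := logpow_tail_MVT k c1 (lt_le_trans ltr01 N1) NS.
have h := logpow_dist_le k c0 N1 (ltW Nz) (ltW zN).
rewrite distrC in h; move: tailE h; rewrite big_nat_recr//= -(natr1 N).
have -> : N%:R + 1 + v - (N%:R + v) = 1 by ring.
rewrite mulr1 => tailE h.
have := le_trans (ler_normD _ _) (lerD IH h); rewrite -mulrDr subrKA.
congr (`|_| <= _); rewrite -tailE; ring.
Qed.

Lemma logpow_tail_ge0 c k x : 1 < c -> 1 <= x -> 0 <= logpow_tail c k x.
Proof.
move=> c1 x1; have d0 : 0 <= c - 1 by rewrite subr_ge0 ltW.
by rewrite mulr_ge0 ?invr_ge0 ?exprn_ge0// poisson_cdf_ge0// mulr_ge0// ln_ge0.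
Qed.

Lemma logpow_sum_le c v k N : 1 < c -> 1 <= v ->
  \sum_(0 <= n < N) logpow c k (n%:R + v) <= logpow_tail c k v + 2 * c ^- k.
Proof.
move=> c1 v1; have c0 : 0 < c by exact: lt_trans c1.
have N1 : 1 <= N%:R + v by rewrite ler_wpDl.
have := logpow_sum_dist k N c1 v1; rewrite ler_norml => /andP[_].
rewrite lerBlDl => /le_trans; apply.
rewrite lerD//; first by rewrite gerBl logpow_tail_ge0.
rewrite mulrC ler_wpM2r ?invr_ge0 ?exprn_ge0 ?(ltW c0)//.
by rewrite lerBlDr (le_trans (logpow_osc_le2 _ _ _))// lerDl logpow_osc_ge0.
Qed.

Lemma is_cvg_logpow_series c v k : 1 < c -> 1 <= v ->
  cvgn (series (fun n => logpow c k (n%:R + v))).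
Proof.
move=> c1 v1; apply: nondecreasing_is_cvgn.
  apply/nondecreasing_seqP => n; rewrite /series /= big_nat_recr//= lerDl.
  by rewrite logpow_ge0// ler_wpDl.
exists (logpow_tail c k v + 2 * c ^- k) => _ [N _ <-].
exact: logpow_sum_le.
Qed.

Definition logpow_sum c v k : R := limn (series (fun n => logpow c k (n%:R + v))).

Lemma logpow_tail_cvg0 c v k (e : R) : 1 < c -> 1 <= v -> 0 < e ->
  \forall N \near \oo, logpow_tail c k (N%:R + v) <= e.
Proof.
move=> c1 v1 e0; have d0 : 0 < c - 1 by rewrite subr_gt0.
set K := (c - 1) ^- k.+1 * ((k.+1 * k.+1)%:R / (c - 1)).
have K0 : 0 < K by rewrite mulr_gt0 ?invr_gt0 ?exprn_gt0// divr_gt0.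
near=> N.
have NK : expR (K / e) <= N%:R + v.
  rewrite (@le_trans _ _ N%:R)//; last by rewrite lerDl (le_trans _ v1).
  by near: N; exact: nbhs_infty_ger.
have N0 : 0 < N%:R + v by rewrite ltr_wpDl// (lt_le_trans _ v1).
have lnN : K / e <= ln (N%:R + v).
  by rewrite -[leLHS]expRK ler_ln// posrE expR_gt0.
have Ke0 : 0 < K / e by rewrite divr_gt0.
have ln0 := lt_le_trans Ke0 lnN.
rewrite /logpow_tail.
apply: (@le_trans _ _ (K / ln (N%:R + v))).
  rewrite /K -mulrA ler_pM2l ?invr_gt0 ?exprn_gt0// -mulrA -invfM.
  by apply: poisson_cdf_le; rewrite mulr_gt0.
by rewrite ler_pdivrMr// mulrC -ler_pdivrMr.
Unshelve. all: end_near. Qed.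

Lemma logpow_sum_tail_dist c v k : 1 < c -> 1 <= v ->
  `|logpow_sum c v k - logpow_tail c k v| <= 2 * c ^- k.
Proof.
move=> c1 v1; have c0 : 0 < c by exact: lt_trans c1.
have cS := is_cvg_logpow_series c1 v1.
rewrite ler_distl; apply/andP; split; last first.
  rewrite limr_le//; apply: nearW => N.
  by rewrite /series /= logpow_sum_le.
apply/ler_addgt0Pr => e e0.
have := logpow_tail_cvg0 k c1 v1 e0 => -[N _ /(_ N (leqnn _))] /= tN.
apply: (@le_trans _ _ (series (fun n => logpow c k (n%:R + v)) N + e)); last first.
  rewrite lerD2r; apply: nondecreasing_cvgn_le => //.
  apply/nondecreasing_seqP => n; rewrite /series /= big_nat_recr//= lerDl.
  by rewrite logpow_ge0// ler_wpDl.
have N1 : 1 <= N%:R + v by rewrite ler_wpDl.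
have := logpow_sum_dist k N c1 v1; rewrite ler_norml => /andP[+ _].
have : c ^- k * (logpow_osc c k v - logpow_osc c k (N%:R + v)) <= 2 * c ^- k.
  rewrite mulrC ler_wpM2r ?invr_ge0 ?exprn_ge0 ?(ltW c0)//.
  by rewrite lerBlDr (le_trans (logpow_osc_le2 _ _ _))// lerDl logpow_osc_ge0.
rewrite /series /=; move: (\sum_(_ <= _ < _) _) tN => A.
move: (logpow_tail c k v) (logpow_tail c k _) (c ^- k * _) => ? ? ?.
by move=> *; lra.
Qed.

Lemma logpow_le c k x : 0 < c -> 1 <= x -> logpow c k x <= c ^- k.
Proof.
move=> c0 x1; rewrite logpowE ?(lt_le_trans _ x1)// ler_piMr//.
  by rewrite invr_ge0 exprn_ge0// ltW.
by rewrite poisson_pmf_le1// mulr_ge0 ?ln_ge0// ltW.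
Qed.

(** The Taylor coefficients at s = c, in powers of c - s, of the difference of
    the Hurwitz zeta function and its polar part 1 / (s - 1). *)
Definition regular_coef c v k : R := logpow_sum c v k - (c - 1) ^- k.+1.

(** The integral of [logpow c k] over [1, +oo[ is exactly (c - 1)^(-k-1), so the
    coefficient compares a sum with an integral. Its decay like c^(-k) gives the
    radius of convergence c, that is, a disk reaching the line Re s = 0. *)
Lemma regular_coef_le c v k : 1 < c -> 1 <= v ->
  `|regular_coef c v k| <= (v + 1) * c ^- k.
Proof.
move=> c1 v1; have c0 : 0 < c by exact: lt_trans c1.
have tail1 : logpow_tail c k 1 = (c - 1) ^- k.+1.
  by rewrite /logpow_tail ln1 mulr0 poisson_cdf_at0 mulr1.
have h1 : `|logpow_tail c k v - logpow_tail c k 1| <= (v - 1) * c ^- k.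
  move: v1; rewrite le_eqVlt => /predU1P[<-|v1]; first by rewrite !subrr normr0 mul0r.
  have [z /andP[z1 zv]] := logpow_tail_MVT k c1 ltr01 v1.
  rewrite distrC => ->.
  rewrite ger0_norm; last first.
    by rewrite mulr_ge0 ?logpow_ge0 ?subr_ge0 ?ltW.
  by rewrite mulrC ler_wpM2l ?logpow_le ?subr_ge0 ?ltW.
have := logpow_sum_tail_dist k c1 v1.
rewrite /regular_coef -tail1 => h2.
have {h1 h2} := lerD h2 h1 => /(le_trans (ler_normD _ _)).
rewrite subrKA => /le_trans; apply.
by rewrite -mulrDl le_eqVlt; apply/orP; left; apply/eqP; congr (_ * _); ring.
Qed.

Lemma regular_coef_shift c v k : 1 < c -> 1 <= v ->
  regular_coef c v k - regular_coef c (v + 1) k = logpow c k v.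
Proof.
move=> c1 v1; rewrite /regular_coef opprB addrA subrK.
have v2 : 1 <= v + 1 by rewrite ler_wpDr// (le_trans _ v1).
have shift : (fun n => logpow c k (n.+1%:R + v)) =
    (fun n => logpow c k (n%:R + (v + 1))).
  by apply/funext => n; congr (logpow _ _ _); rewrite -natr1; ring.
rewrite /logpow_sum (lim_series_recl (u := fun n => logpow c k (n%:R + v))).
  by rewrite shift addrK add0r.
by rewrite shift; exact: is_cvg_logpow_series.
Qed.

End log_power_sums.

(** * Taylor expansion of the Hurwitz series *)

Section hurwitz_expansion.
Context {R : realType}.
Implicit Types (x y c v s : R) (k n N : nat).

(** Half of the theorem of Tonelli for nonnegative double series; the other half
    is the same inequality for the transposed family. *)
Lemma series_exchange_le (f : nat -> nat -> R) (g h : R ^nat) K :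
  (forall n k, 0 <= f n k) ->
  (forall n, series (f n) @ \oo --> g n) ->
  (forall k, series (f ^~ k) @ \oo --> h k) ->
  cvgn (series g) -> series h K <= limn (series g).
Proof.
move=> f0 fg fh cg.
have f_le n : series (f n) K <= g n.
  by rewrite -(cvg_lim _ (fg n))//; apply: series_le_lim => //; exact: cvgP (fg n).
have g0 n : 0 <= g n.
  by rewrite (le_trans _ (f_le n))// /series /= sumr_ge0.
have : (fun N => \sum_(0 <= k < K) series (f ^~ k) N) @ \oo --> series h K.
  by apply: (cvg_big add_continuous) => k _; exact: fh.
move=> /[dup] /cvgP ch /cvg_lim <- //.
apply: limr_le => //; apply: nearW => N.
rewrite /series /= exchange_big /=.
apply: (@le_trans _ _ (series g N)); last exact: series_le_lim.
by apply: ler_sum => n _; exact: f_le.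
Qed.

Lemma series_exchange (f : nat -> nat -> R) (g h : R ^nat) :
  (forall n k, 0 <= f n k) ->
  (forall n, series (f n) @ \oo --> g n) ->
  (forall k, series (f ^~ k) @ \oo --> h k) ->
  cvgn (series g) -> series h @ \oo --> limn (series g).
Proof.
move=> f0 fg fh cg.
have h_le K := series_exchange_le K f0 fg fh cg.
have h0 k : 0 <= h k.
  rewrite -(cvg_lim _ (fh k))//; apply: limr_ge; first exact: cvgP (fh k).
  by apply: nearW => n; rewrite /series /= sumr_ge0.
have ch : cvgn (series h).
  apply: nondecreasing_is_cvgn.
    by apply/nondecreasing_seqP => n; rewrite /series /= big_nat_recr//= lerDl.
  by exists (limn (series g)) => _ [N _ <-].
suff -> : limn (series g) = limn (series h) by [].
apply/eqP; rewrite eq_le; apply/andP; split; apply: limr_le => //; apply: nearW => // N.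
exact: (@series_exchange_le (fun k n => f n k)).
Qed.

Lemma logpow_series c s x : 0 < x ->
  series (fun k => logpow c k x * (c - s) ^+ k) @ \oo --> x `^ (- s).
Proof.
move=> x0.
have -> : (fun k => logpow c k x * (c - s) ^+ k) =
    (fun k => x `^ (- c) *: exp_coeff (ln x * (c - s)) k).
  apply/funext => k; rewrite /logpow /exp_coeff /= /GRing.scale /= exprMn.
  by rewrite -!mulrA [_^-1 * _]mulrC.
have -> : x `^ (- s) = x `^ (- c) *: expR (ln x * (c - s)).
  rewrite /powR gt_eqF// /GRing.scale /= -expRD; congr expR; ring.
rewrite seriesZ; apply: cvgZl_tmp.
exact: is_cvg_series_exp_coeff.
Qed.

Lemma logpow0 s x : logpow s 0 x = x `^ (- s).
Proof. by rewrite /logpow expr0 fact0 divr1 mulr1. Qed.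

Lemma is_cvg_hurwitz_series s v : 1 < s -> 1 <= v ->
  cvgn (series (fun n => (n%:R + v) `^ (- s))).
Proof.
move=> s1 v1; have := is_cvg_logpow_series (k := 0) s1 v1.
by under eq_fun do rewrite logpow0.
Qed.

Lemma pole_series c s : 1 < s -> s <= c ->
  series (fun k => (c - 1) ^- k.+1 * (c - s) ^+ k) @ \oo --> (s - 1)^-1.
Proof.
move=> s1 sc.
have d0 : 0 < c - 1 by rewrite subr_gt0 (lt_le_trans s1).
have -> : (s - 1)^-1 = (c - 1)^-1 * (1 - (c - s) / (c - 1))^-1.
  by field; rewrite !gt_eqF// ?subr_gt0//; lra.
have -> : (fun k => (c - 1) ^- k.+1 * (c - s) ^+ k) =
    geometric ((c - 1)^-1) ((c - s) / (c - 1)).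
  by apply/funext => k; rewrite /geometric /= expr_div_n exprS invfM mulrAC mulrA.
apply: cvg_geometric_series.
have q0 : 0 <= (c - s) / (c - 1) by rewrite divr_ge0 ?(ltW d0)// subr_ge0.
by rewrite ger0_norm// ltr_pdivrMr// mul1r; lra.
Qed.

(** On 1 < s <= c all terms (c - s)^k x^(-c) (ln x)^k / k! are nonnegative, so the
    sums over k and over x = v, v + 1, ... can be exchanged. *)
Lemma hurwitz_series_expansion c v s : 1 <= v -> 1 < s -> s <= c ->
  series (fun k => regular_coef c v k * (c - s) ^+ k) @ \oo -->
    hurwitz_series s v - (s - 1)^-1.
Proof.
move=> v1 s1 sc; have c1 : 1 < c by exact: lt_le_trans sc.
have -> : (fun k => regular_coef c v k * (c - s) ^+ k) =
    (fun k => logpow_sum c v k * (c - s) ^+ k) -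
    (fun k => (c - 1) ^- k.+1 * (c - s) ^+ k).
  by apply/funext => k; rewrite !fctE -mulrBl.
rewrite seriesD seriesN; apply: cvgB; last exact: pole_series.
apply: (@series_exchange (fun n k => logpow c k (n%:R + v) * (c - s) ^+ k)).
- move=> n k; rewrite mulr_ge0 ?exprn_ge0 ?subr_ge0// logpow_ge0//.
  by rewrite ler_wpDl.
- move=> n; apply: logpow_series.
  by rewrite ltr_wpDl// (lt_le_trans _ v1).
- move=> k; have cl := is_cvg_logpow_series (k := k) c1 v1.
  rewrite (_ : series _ = fun n => series (fun n => logpow c k (n%:R + v)) n *
      (c - s) ^+ k); first exact: cvgMr_tmp.
  by apply/funext => n; rewrite /series /= mulr_suml.
- exact: is_cvg_hurwitz_series.
Qed.

End hurwitz_expansion.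

(** * The Hurwitz zeta function on the half-plane Re s > 0 *)

Section continuation.
Context {R : realType}.
Local Open Scope complex_scope.
Implicit Types (c v s : R) (z w : R[i]).

Lemma cvg_real_complex (u : R ^nat) (l : R) : u @ \oo --> l ->
  (fun n => (u n)%:C) @ \oo --> l%:C.
Proof.
move=> /cvgrPdist_lt h; apply/cvg_normcP => e e0.
by apply: filterS (h e e0) => n; rewrite -rmorphB normcR distrC.
Qed.

Lemma series_real_complex (u : R ^nat) n :
  series (fun k => (u k)%:C) n = (series u n)%:C.
Proof. by rewrite /series /= rmorph_sum. Qed.

(** The sign turns powers of c - z into powers of z - c. *)
Definition regular_coefC c v k : R[i] := ((-1) ^+ k * regular_coef c v k)%:C.

Lemma regular_coefC_real c v k s :
  regular_coefC c v k * (s%:C - c%:C) ^+ k = (regular_coef c v k * (c - s) ^+ k)%:C.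
Proof.
rewrite /regular_coefC -rmorphB -rmorphXn -rmorphM; congr (_%:C).
by rewrite -(opprB c s) (exprNn (c - s)) mulrACA -exprMn mulrNN mulr1 expr1n mul1r.
Qed.

Lemma is_cvg_regular_majorant c v (r : R) : 1 < c -> 1 <= v -> 0 <= r < c ->
  cvgn (series (fun k => normc (regular_coefC c v k) * r ^+ k)).
Proof.
move=> c1 v1 /andP[r0 rc]; have c0 : 0 < c by exact: lt_trans c1.
have cg : cvgn (series (geometric (v + 1) (r / c))).
  apply: is_cvg_geometric_series.
  by rewrite ger0_norm ?divr_ge0 ?(ltW c0)// ltr_pdivrMr// mul1r.
apply: (series_le_cvg _ _ _ cg) => k.
- by rewrite mulr_ge0 ?normc_ge0 ?exprn_ge0.
- rewrite /geometric /= mulr_ge0 ?exprn_ge0 ?divr_ge0 ?(ltW c0)//.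
  by rewrite addr_ge0// (le_trans _ v1).
- rewrite /regular_coefC normcR normrM normrX normrN1 expr1n mul1r.
  rewrite /geometric /= expr_div_n mulrCA [X in _ <= X]mulrC -mulrA.
  by rewrite mulrC -mulrA [r ^+ _ * _]mulrC mulrA ler_wpM2r ?exprn_ge0// mulrC regular_coef_le.
Qed.

(** The sum of the series, on the disk of center c and radius c. *)
Definition regular_part c v z : R[i] :=
  xget 0 [set l | series (fun k => regular_coefC c v k * (z - c%:C) ^+ k) @ \oo --> l].

Lemma regular_partP c v z : 1 < c -> 1 <= v -> normc (z - c%:C) < c ->
  series (fun k => regular_coefC c v k * (z - c%:C) ^+ k) @ \oo --> regular_part c v z.
Proof.
move=> c1 v1 zc; rewrite /regular_part; case: xgetP => // /(_ _) nocvg; exfalso.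
have [|l lP] := @abs_summable_cvg R
    (fun k => regular_coefC c v k * (z - c%:C) ^+ k).
  rewrite /abs_summable; under eq_fun do rewrite normcM normcX.
  by apply: is_cvg_regular_majorant => //; rewrite normc_ge0.
exact: nocvg lP.
Qed.

Lemma regular_part_eq c v z (l : R[i]) : 1 < c -> 1 <= v -> normc (z - c%:C) < c ->
  series (fun k => regular_coefC c v k * (z - c%:C) ^+ k) @ \oo --> l ->
  regular_part c v z = l.
Proof.
by move=> c1 v1 zc; apply: complex_cvg_unique; exact: regular_partP.
Qed.

Lemma analytic_regular_part c v z0 : 1 < c -> 1 <= v -> normc (z0 - c%:C) < c ->
  analytic_at (regular_part c v) z0.
Proof.
move=> c1 v1 zc; pose r := (normc (z0 - c%:C) + c) / 2.
have [zr rc] : normc (z0 - c%:C) < r /\ r < c by rewrite /r; split; lra.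
apply: (@analytic_at_power_series _ (regular_coefC c v) c%:C z0 r) => //.
  by apply: is_cvg_regular_majorant; rewrite // rc andbT (le_trans (normc_ge0 _) (ltW zr)).
by move=> z zr'; apply: regular_partP => //; exact: lt_trans rc.
Qed.

Lemma regular_part_real c v s : 1 <= v -> 1 < s -> s <= c ->
  regular_part c v s%:C = (hurwitz_series s v - (s - 1)^-1)%:C.
Proof.
move=> v1 s1 sc; have c1 : 1 < c by exact: lt_le_trans sc.
apply: regular_part_eq => //.
  by rewrite -rmorphB normcR ler0_norm ?subr_le0// opprB gtrBl (lt_trans _ s1).
under eq_fun do rewrite regular_coefC_real.
rewrite (_ : series _ = fun n => (series (fun k => regular_coef c v k * (c - s) ^+ k) n)%:C).
  by apply: cvg_real_complex; exact: hurwitz_series_expansion.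
by apply/funext => n; exact: series_real_complex.
Qed.

(** A shift of v by 1 removes the first term of each sum defining the
    coefficients; the removed terms are the Taylor coefficients of v^(-s). *)
Lemma regular_part_shift c v s : 1 < c -> 1 <= v -> `|s - c| < c ->
  regular_part c v s%:C - regular_part c (v + 1) s%:C = (v `^ (- s))%:C.
Proof.
move=> c1 v1 sc; have v2 : 1 <= v + 1 by rewrite ler_wpDr// (le_trans _ v1).
have sc' : normc (s%:C - c%:C) < c by rewrite -rmorphB normcR.
apply: (complex_cvg_unique (cvgB (regular_partP c1 v1 sc') (regular_partP c1 v2 sc'))).
rewrite (_ : _ - _ = fun n => (series (fun k => logpow c k v * (c - s) ^+ k) n)%:C).
  by apply: cvg_real_complex; apply: logpow_series; exact: lt_le_trans v1.
apply/funext => n; rewrite !fctE /series /= -sumrB rmorph_sum; apply: eq_bigr => k _.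
by rewrite !regular_coefC_real -rmorphB -mulrBl regular_coef_shift.
Qed.

Lemma disk_le c c' z : c <= c' -> normc (z - c%:C) < c -> normc (z - c'%:C) < c'.
Proof.
move=> cc zc; rewrite (le_lt_trans (le_normc_dist z c%:C c'%:C))//.
rewrite -rmorphB normcR ler0_norm ?subr_le0// opprB.
by rewrite -ltrBrDr subKr.
Qed.

(** The disks are nested and the functions agree on the real interval ]1, c],
    which accumulates at the center of the smaller disk. *)
Lemma regular_part_nested c c' v z : 1 < c -> c <= c' -> 1 <= v ->
  normc (z - c%:C) < c -> regular_part c v z = regular_part c' v z.
Proof.
move=> c1 cc v1 zc; have c1' : 1 < c' by exact: lt_le_trans cc.
have c0 : 0 < c by exact: lt_trans c1.
pose f w := regular_part c v w - regular_part c' v w.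
have fan w : normc (w - c%:C) < c -> analytic_at f w.
  move=> wc; apply: analytic_atB; first exact: analytic_regular_part.
  by apply: analytic_regular_part => //; exact: disk_le wc.
have f0 s : 1 < s -> s <= c -> f s%:C = 0.
  move=> s1 sc; rewrite /f !regular_part_real ?subrr//.
  exact: le_trans cc.
have cc0 : normc (c%:C - c%:C) < c by rewrite subrr normc0.
have fc : \forall w \near c%:C, f w = 0.
  apply: analytic_zero; first exact: fan.
  move=> e e0; pose t := Num.min (e / 2) ((c - 1) / 2).
  have t0 : 0 < t by rewrite lt_min !divr_gt0// subr_gt0.
  have te : t < e by rewrite (@le_lt_trans _ _ (e / 2)) ?ge_min ?lexx//; lra.
  have tc : t < c - 1.
    by rewrite (@le_lt_trans _ _ ((c - 1) / 2)) ?ge_min ?lexx ?orbT//; lra.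
  exists (c - t)%:C; rewrite -rmorphB normcR addrAC subrr add0r normrN gtr0_norm//.
  by split=> //; apply: f0; lra.
have fz : \forall w \near z, f w = 0.
  apply: analytic_zero_segment fc => t /andP[t0 t1]; apply: fan.
  rewrite addrAC subrr add0r normcM normcR ger0_norm//.
  by rewrite (le_lt_trans _ zc)// ler_piMl// normc_ge0.
by apply/eqP; rewrite -subr_eq0; apply/eqP; exact: (nbhs_singleton fz).
Qed.

(** The disk with this center c and radius c contains z when Re z > 0. *)
Definition disk_center z : R :=
  (complex.Re z ^+ 2 + complex.Im z ^+ 2) / (2 * complex.Re z) + 2.

Lemma disk_center_gt1 z : 0 < complex.Re z -> 1 < disk_center z.
Proof.
move=> z0; rewrite /disk_center ltr_wpDl ?ltr1n// divr_ge0 ?addr_ge0 ?sqr_ge0//.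
by rewrite mulr_ge0// ltW.
Qed.

Lemma disk_centerP z : 0 < complex.Re z -> normc (z - (disk_center z)%:C) < disk_center z.
Proof.
move=> z0; have c1 := disk_center_gt1 z0; have c0 := lt_trans ltr01 c1.
move: c0; rewrite /disk_center; case: z z0 {c1} => x y /= x0.
set c := _ + 2 => c0; rewrite subr0 -(ltr_pXn2r (n := 2))// ?nnegrE ?sqrtr_ge0 ?ltW//.
rewrite sqr_sqrtr ?addr_ge0 ?sqr_ge0//.
have : (c - 2) * (2 * x) = x ^+ 2 + y ^+ 2.
  by rewrite /c addrK divfK// mulf_neq0 ?gt_eqF// pnatr_eq0.
by nra.
Qed.

Definition continuation v z : R[i] := (z - 1)^-1 + regular_part (disk_center z) v z.

Lemma continuationE c v z : 1 < c -> 1 <= v -> 0 < complex.Re z -> normc (z - c%:C) < c ->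
  continuation v z = (z - 1)^-1 + regular_part c v z.
Proof.
move=> c1 v1 z0 zc; rewrite /continuation; congr (_ + _).
have d1 := disk_center_gt1 z0; have dz := disk_centerP z0.
have [cd|/ltW dc] := leP c (disk_center z); last exact: regular_part_nested.
by rewrite (regular_part_nested c1 cd).
Qed.

Lemma near_Re_gt0 z0 : 0 < complex.Re z0 -> \forall z \near z0, 0 < complex.Re z.
Proof.
move=> z00; apply/near_normcP; exists (complex.Re z0) => // z zz0.
have := le_lt_trans (le_normcRe (z - z0)) zz0.
have -> : complex.Re (z - z0) = complex.Re z - complex.Re z0.
  by case: z {zz0}; case: z0 {z00}.
by rewrite ltr_norml => /andP[]; lra.
Qed.

Lemma continuationP v : 1 <= v -> is_hurwitz_continuation v (continuation v).
Proof.
move=> v1; split=> [z0 z00 z01|s s1].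
  have c1 := disk_center_gt1 z00; have cz0 := disk_centerP z00.
  set c := disk_center z0 in c1 cz0.
  apply: (@analytic_at_near _ (fun z => (z - 1)^-1 + regular_part c v z)).
    have nearc : \forall z \near z0, normc (z - c%:C) < c.
      apply/near_normcP; exists (c - normc (z0 - c%:C)); first by rewrite subr_gt0.
      move=> z; rewrite ltrBrDr => /(le_lt_trans _); apply.
      exact: le_normc_dist.
    by apply: filterS2 (near_Re_gt0 z00) nearc => z zr zc; rewrite (continuationE c1).
  by apply: analytic_atD; [exact: analytic_at_inv|exact: analytic_regular_part].
rewrite (continuationE s1) ?subrr ?normc0//; try by rewrite (lt_trans _ s1).
rewrite regular_part_real// rmorphB /= fmorphV rmorphB rmorph1 addrC subrK//.
Qed.

(** The path from 2 to 1 + i and then to s stays in the half-plane and avoids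
    the pole. *)
Lemma hurwitz_continuation_unique v (f g : R[i] -> R[i]) s :
  is_hurwitz_continuation v f -> is_hurwitz_continuation v g ->
  0 < s -> s != 1 -> f s%:C = g s%:C.
Proof.
move=> [fan fs] [gan gs] s0 s1.
pose h z := f z - g z.
have han z : 0 < complex.Re z -> z <> 1 -> analytic_at h z.
  by move=> z0 z1; apply: analytic_atB; [exact: fan|exact: gan].
have h2 : \forall z \near (2 : R)%:C, h z = 0.
  apply: analytic_zero; first by apply: han => /=; [lra|move=> [] *; lra].
  move=> e e0; exists (2 + e / 2)%:C.
  rewrite -rmorphB normcR addrAC subrr add0r gtr0_norm ?divr_gt0//; split=> //; first by lra.
  by rewrite /h fs ?gs ?subrr//; lra.
have h1i : \forall z \near 1 +i* 1, h z = 0.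
  apply: analytic_zero_segment h2 => t /andP[t0 t1]; apply: han => /=; first by lra.
  by move=> [] a b; lra.
have hs : \forall z \near s%:C, h z = 0.
  apply: analytic_zero_segment h1i => t /andP[t0 t1]; apply: han => /=.
    have [s_lt|s_ge] := ltP s 1; nra.
  move=> [] a b; have t_eq : t = 1 by lra.
  by move: a s1; rewrite t_eq => a /eqP; lra.
by apply/eqP; rewrite -subr_eq0; apply/eqP; exact: (nbhs_singleton hs).
Qed.

(** By uniqueness, the value of the chosen continuation is that of the one
    constructed above; existence excludes the default value of the choice. *)
Lemma hurwitz_zetaE s v : 1 <= v -> 0 < s -> s != 1 ->
  hurwitz_zeta s v = complex.Re (continuation v s%:C).
Proof.
move=> v1 s0 s1; rewrite /hurwitz_zeta; congr complex.Re.
have vP := continuationP v1.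
by apply: (@hurwitz_continuation_unique v) => //; apply: xgetPex; exists (continuation v).
Qed.

(** The disk of center s + 1 contains s for all s > 0, also where the Hurwitz
    series diverges, and the polar parts cancel. *)
Lemma hurwitz_zeta_shift s v : 1 <= v -> 0 < s -> s != 1 ->
  hurwitz_zeta s v - hurwitz_zeta s (v + 1) = v `^ (- s).
Proof.
move=> v1 s0 s1; have v2 : 1 <= v + 1 by rewrite ler_wpDr// (le_trans _ v1).
have c1 : 1 < s + 1 by rewrite ltrDr.
have sc : `|s - (s + 1)| < s + 1 by rewrite opprD addrA subrr sub0r normrN1.
have sc' : normc (s%:C - (s + 1)%:C) < s + 1 by rewrite -rmorphB normcR.
rewrite !hurwitz_zetaE// !(continuationE (c := s + 1))//.
have := congr1 (@complex.Re R) (regular_part_shift c1 v1 sc) => /= <-.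
case: (regular_part _ _ _) => x ?; case: (regular_part _ _ _) => y ?.
case: (_^-1) => a ? /=; ring.
Qed.

End continuation.

(** * The Gamma integral *)

Section gamma.
Context {R : realType}.
Implicit Types (p t x y v : R) (n : nat).
Local Notation mu := (@lebesgue_measure R).

Definition gamma_integrand p t : R := t `^ p * expR (- t).

Lemma gamma_integrand_ge0 p t : 0 <= gamma_integrand p t.
Proof. by rewrite mulr_ge0 ?powR_ge0 ?expR_ge0. Qed.

Lemma measurable_gamma_integrand p (D : set R) :
  measurable_fun D (gamma_integrand p).
Proof.
apply: measurable_funTS; apply: measurable_funM; first exact: measurable_powR.
by apply: measurableT_comp => //; exact: measurable_expR.
Qed.

Definition gamma_majorant_const n : R := 1 + 2 ^+ n.+1 * (n.+1)`!%:R.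

Lemma gamma_majorant_const_gt0 n : 0 < gamma_majorant_const n.
Proof. by rewrite /gamma_majorant_const ltr_pwDl// mulr_ge0// exprn_ge0. Qed.

(** The term of degree n + 1 of the exponential series at t/2 bounds t^(n+1), and
    t^p <= 1 + t^(n+1); one half of the decay of e^(-t) is left. *)
Lemma gamma_integrand_le p n t : 0 <= p -> p <= n.+1%:R -> 0 < t ->
  gamma_integrand p t <= gamma_majorant_const n * expR (- (t / 2)).
Proof.
move=> p0 pn t0; have t20 : 0 <= t / 2 by rewrite divr_ge0// ltW.
have h1 : 1 <= expR (t / 2) by rewrite -[leLHS]expR0 ler_expR.
have h2 : t ^+ n.+1 <= 2 ^+ n.+1 * (n.+1)`!%:R * expR (t / 2).
  have := expR_ge1Dxn n t20 => h.
  have {h} : (t / 2) ^+ n.+1 / (n.+1)`!%:R <= expR (t / 2).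
    by rewrite (le_trans _ h)// lerDr.
  rewrite expr_div_n ler_pdivrMr ?ltr0n ?fact_gt0// ler_pdivrMr ?exprn_gt0//.
  by rewrite -mulrA mulrC [X in X * _]mulrC.
have tp : t `^ p <= gamma_majorant_const n * expR (t / 2).
  rewrite mulrDl mul1r; have [t1|/ltW t1] := leP t 1.
    apply: (@le_trans _ _ 1); last first.
      by rewrite ler_wpDr// mulr_ge0 ?expR_ge0// mulr_ge0// exprn_ge0.
    have := @ge0_ler_powR R p p0 t 1.
    by rewrite !nnegrE powR1 => -> //; exact: ltW.
  apply: (@le_trans _ _ (t ^+ n.+1)); last by rewrite ler_wpDl// expR_ge0.
  by rewrite -powR_mulrn ?(ltW t0)// ler_powR.
rewrite /gamma_integrand.
have -> : - t = - (t / 2) + - (t / 2) by rewrite -opprD -splitr.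
rewrite expRD mulrA ler_wpM2r ?expR_ge0//.
by rewrite expRN ler_pdivrMr// expR_gt0.
Qed.

Lemma integrable_gamma_majorant (k : R) :
  mu.-integrable `]0, +oo[ (fun t => (k * expR (- (t / 2)))%:E).
Proof.
have h : (0 : R) < 2^-1 by rewrite invr_gt0.
have mS : mu.-integrable `]0, +oo[%classic (EFin \o exponential_pdf (2^-1 : R)).
  by apply: integrableS (integrable_exponential_pdf h).
have : mu.-integrable `]0, +oo[%classic
    (fun t => (2 * k)%:E * (EFin \o exponential_pdf (2^-1 : R)) t)%E.
  exact: integrableZl.
apply: eq_integrable => // t; rewrite inE /= in_itv /= andbT => t0.
rewrite /exponential_pdf patchE ifT; last by rewrite inE /= in_itv /= andbT ltW.
by rewrite -EFinM mulrA (mulrC 2) -(mulrA k) divff// mulr1 mulNr [_^-1 * _]mulrC.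
Qed.

Lemma integrable_gamma_integrand p : 0 <= p ->
  mu.-integrable `]0, +oo[ (EFin \o gamma_integrand p).
Proof.
move=> p0; pose n := Num.truncn p.
have := integrable_gamma_majorant (gamma_majorant_const n).
apply: le_integrable => //.
  by apply/measurable_EFinP; exact: measurable_gamma_integrand.
move=> t; rewrite /= in_itv /= andbT => t0.
rewrite lee_fin ger0_norm ?gamma_integrand_ge0// (le_trans _ (ler_norm _))//.
by apply: gamma_integrand_le => //; rewrite ltW// truncnS_gt.
Qed.

Lemma is_derive_gamma_integrand p t : 0 < t ->
  is_derive t 1 (gamma_integrand p)
    (p * gamma_integrand (p - 1) t - gamma_integrand p t).
Proof.
move=> t0; rewrite /gamma_integrand.
have h := is_derive1_powR p t0.
apply: is_derive_eq; rewrite /GRing.scale /=; ring.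
Qed.

Lemma continuous_gamma_integrand p t : 0 < t -> {for t, continuous (gamma_integrand p)}.
Proof.
move=> t0; apply: differentiable_continuous; apply/derivable1_diffP.
by have [] := is_derive_gamma_integrand p t0.
Qed.

Lemma within_continuous_gamma_integrand p (a b : R) : 0 < a ->
  {within `[a, b], continuous (gamma_integrand p)}.
Proof.
move=> a0; apply: continuous_in_subspaceT => t; rewrite inE /= in_itv /= => /andP[at_ _].
by apply: continuous_gamma_integrand; exact: lt_le_trans at_.
Qed.

Lemma gamma_integrand_cvgy p : 0 <= p -> gamma_integrand p n.+2%:R @[n --> \oo] --> 0.
Proof.
move=> p0; pose m := Num.truncn p; set K := gamma_majorant_const m.
have K0 : 0 < K by exact: gamma_majorant_const_gt0.
apply/cvgrPdist_lt => e e0; near=> n.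
rewrite sub0r normrN ger0_norm ?gamma_integrand_ge0//.
have n0 : (0 : R) < n.+2%:R by [].
have pm : p <= m.+1%:R by rewrite ltW// truncnS_gt.
rewrite (le_lt_trans (gamma_integrand_le p0 pm n0))// -/K.
rewrite expRN -ltr_pdivlMl// -[X in _ < X]invrK ltf_pV2 ?posrE ?expR_gt0 ?invr_gt0 ?mulr_gt0 ?invr_gt0//.
rewrite invfM invrK (@lt_le_trans _ _ (1 + n.+2%:R / 2))//; last exact: expR_ge1Dx.
rewrite (@le_lt_trans _ _ (n.+2%:R / 2))//; last by rewrite ltrDr.
rewrite ler_pdivlMr// (@le_trans _ _ n%:R)//; last by rewrite ler_nat; lia.
by near: n; exact: nbhs_infty_ger.
Unshelve. all: end_near. Qed.

Lemma gamma_integrand_cvg0 p : 0 < p ->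
  gamma_integrand p n.+2%:R^-1 @[n --> \oo] --> 0.
Proof.
move=> p0; apply/cvgrPdist_lt => e e0; near=> n.
rewrite sub0r normrN ger0_norm ?gamma_integrand_ge0//.
have n0 : (0 : R) < n.+2%:R by [].
rewrite (@le_lt_trans _ _ (n.+2%:R^-1 `^ p))//.
  by rewrite ler_piMr ?powR_ge0// -[leRHS]expR0 ler_expR oppr_le0 invr_ge0.
have -> : e = (e `^ p^-1) `^ p by rewrite -powRrM mulVf ?gt_eqF// powRr1 ?ltW.
have ep : 0 < e `^ p^-1 by rewrite powR_gt0.
apply: gt0_ltr_powR => //; rewrite ?nnegrE ?invr_ge0 ?ltW//.
rewrite -[X in _ < X]invrK ltf_pV2 ?posrE ?invr_gt0//.
rewrite (@le_lt_trans _ _ n%:R)//; last by rewrite ltr_nat; lia.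
by near: n; exact: nbhs_infty_ger.
Unshelve. all: end_near. Qed.

Definition gamma_window n : set R := `[n.+2%:R^-1, n.+2%:R].

Lemma gamma_window_bounds n : (0 : R) < n.+2%:R^-1 /\ (n.+2%:R^-1 : R) < n.+2%:R.
Proof.
split; first by rewrite invr_gt0.
by rewrite (@lt_trans _ _ 1)// ?ltr1n// invf_lt1// ltr1n.
Qed.

Lemma bigcup_gamma_window : \bigcup_n gamma_window n = `]0, +oo[%classic.
Proof.
apply/seteqP; split => [t [n _]|t].
  rewrite /gamma_window /= !in_itv /= andbT => /andP[+ _].
  by apply: lt_le_trans; have [] := gamma_window_bounds n.
rewrite /= in_itv /= andbT => t0.
pose n := maxn (Num.truncn t) (Num.truncn t^-1); exists n => //.
rewrite /gamma_window /= in_itv /=; apply/andP; split.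
  rewrite -[leRHS]invrK lef_pV2 ?posrE ?invr_gt0// (le_trans (ltW (truncnS_gt _)))//.
  by rewrite ler_nat ltnS leqW// leq_maxr.
by rewrite (le_trans (ltW (truncnS_gt _)))// ler_nat ltnS leqW// leq_maxl.
Qed.

Lemma nondecreasing_gamma_window : nondecreasing_seq gamma_window.
Proof.
move=> m n mn; apply/subsetPset => t; rewrite /gamma_window /= !in_itv /=.
move=> /andP[mt tm]; apply/andP; split.
  by rewrite (le_trans _ mt)// lef_pV2 ?posrE// ler_nat.
by rewrite (le_trans tm)// ler_nat.
Qed.

Lemma integrable_gamma_window p n :
  mu.-integrable (gamma_window n) (EFin \o gamma_integrand p).
Proof.
apply: continuous_compact_integrable; first exact: segment_compact.
by apply: within_continuous_gamma_integrand; have [] := gamma_window_bounds n.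
Qed.

Lemma cvg_gamma_window p :
  (\int[mu]_(t in gamma_window n) (gamma_integrand p t)%:E)%E @[n --> \oo] -->
  (\int[mu]_(t in `]0%R, +oo[) (gamma_integrand p t)%:E)%E.
Proof.
rewrite -bigcup_gamma_window; apply: ge0_nondecreasing_set_cvg_integral.
- exact: nondecreasing_gamma_window.
- by move=> n; exact: measurable_itv.
- by move=> n; apply/measurable_EFinP; exact: measurable_gamma_integrand.
- by move=> n t _; rewrite lee_fin gamma_integrand_ge0.
Qed.

Lemma gamma_window_parts p n :
  p * \int[mu]_(t in gamma_window n) gamma_integrand (p - 1) t -
  \int[mu]_(t in gamma_window n) gamma_integrand p t =
  gamma_integrand p n.+2%:R - gamma_integrand p n.+2%:R^-1.
Proof.
have [a0 ab] := gamma_window_bounds n.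
have mW : measurable (gamma_window n) by exact: measurable_itv.
rewrite -RintegralZl//; last exact: integrable_gamma_window.
have iZ : mu.-integrable (gamma_window n)
    (EFin \o (fun t => p * gamma_integrand (p - 1) t)).
  rewrite (_ : _ \o _ = fun t => (p%:E * (gamma_integrand (p - 1) t)%:E)%E).
    by apply: integrableZl => //; exact: integrable_gamma_window.
  by apply/funext => t; rewrite /= EFinM.
rewrite -RintegralB//; last exact: integrable_gamma_window.
rewrite /Rintegral.
rewrite (@continuous_FTC2 _ _ (gamma_integrand p))//.
- move=> t; apply: cvgB; last exact: within_continuous_gamma_integrand.
  by apply: cvgMl_tmp; exact: within_continuous_gamma_integrand.
- split.
  + move=> t; rewrite in_itv /= => /andP[at_ _].
    by have [] := is_derive_gamma_integrand p (lt_trans a0 at_).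
  + by apply: cvg_at_right_filter; exact: continuous_gamma_integrand.
  + by apply: cvg_at_left_filter; apply: continuous_gamma_integrand.
- move=> t; rewrite in_itv /= => /andP[at_ _].
  have h := is_derive_gamma_integrand p (lt_trans a0 at_).
  by rewrite derive1E derive_val.
Qed.

(** Integration by parts on the compact intervals [1/(n+2), n+2]; this also
    shows that the improper integral at exponent p - 1 is finite. *)
Lemma gamma_integral_rec p : 0 < p ->
  (\int[mu]_(t in `]0%R, +oo[) (gamma_integrand (p - 1) t)%:E =
   (p^-1 * \int[mu]_(t in `]0, +oo[) gamma_integrand p t)%R%:E)%E.
Proof.
move=> p0; set B := \int[mu]_(t in _) _.
have BE : (\int[mu]_(t in `]0%R, +oo[) (gamma_integrand p t)%:E = B%:E)%E.
  rewrite /B /Rintegral fineK//; apply: integrable_fin_num => //.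
  by apply: integrable_gamma_integrand; exact: ltW.
have cA := cvg_gamma_window (p := p - 1).
apply: (cvg_unique _ cA) => //.
have cB : \int[mu]_(t in gamma_window n) gamma_integrand p t @[n --> \oo] --> B.
  by have := cvg_gamma_window (p := p); rewrite BE => /fine_cvg.
have -> : (fun n => \int[mu]_(t in gamma_window n) (gamma_integrand (p - 1) t)%:E)%E =
   (fun n => (p^-1 * (\int[mu]_(t in gamma_window n) gamma_integrand p t +
      (gamma_integrand p n.+2%:R - gamma_integrand p n.+2%:R^-1)))%:E).
  apply/funext => n; rewrite -gamma_window_parts [_ + (_ - _)]addrC subrK mulrA mulVf ?gt_eqF// mul1r.
  rewrite /Rintegral fineK//; apply: integrable_fin_num; first exact: measurable_itv.
  exact: integrable_gamma_window.
apply: cvg_EFin; first exact: nearW.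
apply: cvgMl_tmp; rewrite -[X in _ --> X]addr0; apply: cvgD => //.
rewrite -[X in _ --> X]subr0; apply: cvgB.
  by apply: gamma_integrand_cvgy; exact: ltW.
exact: gamma_integrand_cvg0.
Qed.

Lemma GammaE x : Gamma x = \int[mu]_(t in `]0, +oo[) gamma_integrand (x - 1) t.
Proof. by []. Qed.

Lemma GammaD1 x : 0 < x -> Gamma (x + 1) = x * Gamma x.
Proof.
move=> x0; rewrite !GammaE addrK [in RHS]/Rintegral gamma_integral_rec//=.
by rewrite mulrA divff ?mul1r// gt_eqF.
Qed.

End gamma.

(** * The digamma function *)

Section digamma_shift.
Context {R : realType}.
Implicit Types (t x v : R) (n : nat).
Local Notation mu := (@lebesgue_measure R).

Lemma is_derive_gamma_exponent t x : 0 < t ->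
  is_derive x 1 (fun y => gamma_integrand (y - 1) t)
    (ln t * gamma_integrand (x - 1) t).
Proof.
move=> t0.
have -> : (fun y => gamma_integrand (y - 1) t) =
    expR (- t) *: (expR \o (ln t *: ((@id R) - cst 1))).
  apply/funext => y; rewrite /gamma_integrand /powR gt_eqF// mulrC.
  by rewrite /= !fctE /GRing.scale /= [_ * ln t]mulrC.
apply: is_derive_eq; rewrite /gamma_integrand /powR gt_eqF// /GRing.scale /= !fctE /GRing.scale /=.
by rewrite subr0 mulr1 [(x - 1) * _]mulrC; ring.
Qed.

(** |ln t| <= t + 1/t moves the logarithm into the exponents x and x - 2. *)
Lemma gamma_log_integrand_le n t x : 0 < t -> 2 <= x -> x <= n.+1%:R ->
  `|ln t * gamma_integrand (x - 1) t| <=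
  2 * gamma_majorant_const n * expR (- (t / 2)).
Proof.
move=> t0 x2 xn; rewrite normrM [X in _ * X]ger0_norm ?gamma_integrand_ge0//.
have lnt : `|ln t| <= t + t^-1.
  have tV0 : 0 < t^-1 by rewrite invr_gt0.
  have h1 := ln_sublinear t0; have := ln_sublinear tV0; rewrite lnV ?posrE// => h2.
  by rewrite ler_norml; apply/andP; split; lra.
have pw : (t + t^-1) * gamma_integrand (x - 1) t =
    gamma_integrand x t + gamma_integrand (x - 2) t.
  rewrite /gamma_integrand mulrA -mulrDl; congr (_ * _).
  rewrite mulrDl -[X in X * _ + _]powRr1 ?(ltW t0)// -powR_inv1 ?(ltW t0)//.
  by rewrite -!powRD ?(gt_eqF t0) ?implybT//; congr (_ `^ _ + _ `^ _); ring.
apply: (@le_trans _ _ ((t + t^-1) * gamma_integrand (x - 1) t)).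
  by rewrite ler_wpM2r// gamma_integrand_ge0.
rewrite pw -mulrA mulrDl mul1r lerD// gamma_integrand_le//; lra.
Qed.

(** Above 2 the exponents in the bound of the derivative are nonnegative, so
    the derivative in x is dominated near t = 0 by a constant. *)
Lemma derivable_Gamma_gt2 x : 2 < x -> derivable (@Gamma R) x 1.
Proof.
move=> x2; pose n := Num.truncn (x + 1).
have xn : x + 1 <= n.+1%:R by rewrite ltW// truncnS_gt.
pose f y t := gamma_integrand (y - 1) t.
have -> : @Gamma R = fun y => \int[mu]_(t in `]0, +oo[) f y t by [].
apply: (@derivable_under_integral R _ _ mu f `]0, +oo[%classic _ x 2 (x + 1) _ _ _
  (fun t => 2 * gamma_majorant_const n * expR (- (t / 2)))).
- exact: measurable_itv.
- by rewrite /= in_itv /= x2 ltrDl ltr01.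
- move=> y; rewrite /= in_itv /= => /andP[y2 _].
  by apply: integrable_gamma_integrand; lra.
- move=> y t _; rewrite /= in_itv /= andbT => t0.
  by have [] := is_derive_gamma_exponent y t0.
- move=> t; rewrite !mulr_ge0 ?expR_ge0//.
  by rewrite ltW// gamma_majorant_const_gt0.
- exact: integrable_gamma_majorant.
- move=> y t; rewrite /= !in_itv /= andbT => /andP[y2 yx] t0.
  have h := is_derive_gamma_exponent y t0.
  rewrite /partial1of2 derive1E derive_val.
  by apply: gamma_log_integrand_le => //; [exact: ltW|lra].
Qed.

Lemma near_pos x : 0 < x -> \forall y \near x, 0 < y.
Proof. by move=> x0; exact: lt_nbhsr. Qed.

(** Near x, Gamma y = Gamma (y + 3) / (y (y + 1) (y + 2)). *)
Lemma derivable_Gamma x : 0 < x -> derivable (@Gamma R) x 1.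
Proof.
move=> x0.
pose g (y : R) := ((@id R) * ((@id R) + cst 1) * ((@id R) + cst 2)) y.
pose h := (fun y => (g y)^-1) * (@Gamma R \o ((@id R) + cst 3)).
have gx : g x != 0 by rewrite /g !fctE /= !mulf_neq0// gt_eqF// addr_gt0.
apply: (@near_eq_derivable _ _ _ h).
- apply: filterS (near_pos x0) => y y0.
  have E : y + 3 = y + 1 + 1 + 1 by ring.
  rewrite /h /g !fctE /= E !GammaD1 ?addr_gt0//.
  by field; rewrite !gt_eqF// addr_gt0.
- apply: derivableM.
    by apply: derivableV => //; rewrite /g.
  apply/derivable1_diffP/differentiable_comp; first exact/derivable1_diffP.
  by apply/derivable1_diffP; apply: derivable_Gamma_gt2; rewrite !fctE /=; lra.
Qed.

Lemma Gamma_gt0 x : 1 <= x -> 0 < Gamma x.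
Proof.
move=> x1; rewrite GammaE.
have i0 : mu.-integrable `]0, +oo[ (EFin \o gamma_integrand (x - 1)).
  by apply: integrable_gamma_integrand; lra.
have sub : `[1, 2]%classic `<=` (`]0, +oo[%classic : set R).
  move=> t; rewrite /= !in_itv /= andbT => /andP[+ _]; exact: lt_le_trans.
apply: (@lt_le_trans _ _ (expR (- 2))); first exact: expR_gt0.
rewrite /Rintegral -lee_fin fineK; last exact: integrable_fin_num.
apply: (@le_trans _ _ (\int[mu]_(t in `[1%R, 2%R]) (gamma_integrand (x - 1) t)%:E)%E);
  last first.
  apply: ge0_subset_integral => //.
    by apply/measurable_EFinP; exact: measurable_gamma_integrand.
  by move=> t _; rewrite lee_fin gamma_integrand_ge0.
apply: (@le_trans _ _ (\int[mu]_(t in `[1%R, 2%R]) (expR (- 2))%:E)%E).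
  rewrite integral_cst//= lebesgue_measure_itv /= lte_fin ltr1n -EFinB -EFinM lee_fin.
  by rewrite (_ : 2 - 1 = 1) ?mulr1//; ring.
apply: ge0_le_integral => //.
- by apply/measurable_EFinP; exact: measurable_gamma_integrand.
- move=> t; rewrite /= in_itv /= => /andP[t1 t2].
  rewrite lee_fin (@le_trans _ _ (expR (- t))) ?ler_expR ?lerN2//.
  rewrite /gamma_integrand ler_peMl ?expR_ge0//.
  by rewrite -[leLHS](powRr0 t) ler_powR// subr_ge0.
Qed.

(** The logarithmic derivative of Gamma (x + 1) = x Gamma x. *)
Lemma digamma_shift v : 1 <= v -> digamma (v + 1) - digamma v = v^-1 :> R.
Proof.
move=> v1; have v0 : 0 < v by exact: lt_le_trans v1.
have dv := derivable_Gamma v0.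
have dv1 : derivable (@Gamma R) (v + 1) 1 by apply: derivable_Gamma; rewrite addr_gt0.
have G0 : Gamma v != 0 by rewrite gt_eqF// Gamma_gt0.
have E : (@Gamma R)^`()%classic (v + 1) = Gamma v + v * (@Gamma R)^`()%classic v.
  have h1 : is_derive v 1 (@Gamma R \o ((@id R) + cst 1)) ((@Gamma R)^`()%classic (v + 1)).
    have hh : is_derive (((@id R) + cst 1) v) 1 (@Gamma R) ((@Gamma R)^`()%classic (v + 1)).
      by rewrite derive1E; exact: DeriveDef dv1 (erefl _).
    by apply: is_derive_eq; rewrite addr0 mulr1.
  have h2 : is_derive v 1 ((@id R) * (@Gamma R)) (Gamma v + v * (@Gamma R)^`()%classic v).
    have hh : is_derive v 1 (@Gamma R) ((@Gamma R)^`()%classic v).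
      by rewrite derive1E; exact: DeriveDef dv (erefl _).
    by apply: is_derive_eq; rewrite /GRing.scale /= mulr1 addrC.
  have <- := @derive_val _ _ _ _ _ _ _ h1.
  have <- := @derive_val _ _ _ _ _ _ _ h2.
  apply: near_eq_derive.
  by apply: filterS (near_pos v0) => y y0; rewrite !fctE /= GammaD1.
rewrite /digamma E GammaD1//; field.
by rewrite G0 gt_eqF.
Qed.

End digamma_shift.

(** * Pareto probabilities of intervals *)

Lemma powR_invl {R : realType} (x r : R) : 0 < x -> x^-1 `^ r = x `^ (- r).
Proof. by move=> x0; rewrite /powR !gt_eqF ?invr_gt0// lnV ?posrE// mulrN mulNr. Qed.

Section pareto_survival.
Context {R : realType} {d : measure_display} {T : measurableType d}.
Context {P : probability T R} {X : {RV P >-> R}} {xm s : R}.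
Hypotheses (hxm : 0 < xm) (hs : 0 < s) (hX : is_pareto X xm s).
Implicit Types (u w x : R) (A : set R).
Local Notation mu := (@lebesgue_measure R).

(** The survival function P(X >= u). *)
Definition pareto_survival (xm s u : R) : R := (xm / Num.max xm u) `^ s.

Lemma pareto_distributionE A : measurable A ->
  distribution P X A =
  (\int[mu]_(x in A `&` `[xm, +oo[) (s * xm `^ s * x `^ (- (s + 1)))%:E)%E.
Proof.
move=> mA; rewrite hX// integral_mkcondr; apply: eq_integral => x _.
by rewrite /pareto_pdf -[RHS]/((EFin \o _) \_ _ x) restrict_EFin.
Qed.

Lemma is_derive_pareto_primitive x : 0 < x ->
  is_derive x 1 (fun y => - (xm `^ s * y `^ (- s))) (s * xm `^ s * x `^ (- (s + 1))).
Proof.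
move=> x0.
have h := is_derive1_powR (- s) x0.
have -> : (fun y => - (xm `^ s * y `^ (- s))) = - (xm `^ s *: (fun y : R => y `^ (- s))).
  by [].
by apply: is_derive_eq; rewrite /GRing.scale /= opprD; ring.
Qed.

Lemma pareto_prob_itv_ge u w : xm <= u -> u <= w ->
  distribution P X `[u, w[ = ((xm / u) `^ s - (xm / w) `^ s)%:E.
Proof.
move=> xu; rewrite le_eqVlt => /predU1P[<-|uw].
  by rewrite set_itvco0 measure0 subrr.
have u0 : 0 < u by exact: lt_le_trans xu.
have w0 : 0 < w by exact: lt_trans uw.
rewrite pareto_distributionE; last exact: measurable_itv.
have -> : `[u, w[%classic `&` `[xm, +oo[%classic = (`[u, w[%classic : set R).
  apply/setIidl => x; rewrite /= !in_itv /= andbT => /andP[ux _].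
  exact: le_trans ux.
have der x : 0 < x -> {for x, continuous (fun y : R => y `^ (- (s + 1)))}.
  move=> x0; apply: differentiable_continuous; apply/derivable1_diffP.
  by have [] := is_derive1_powR (- (s + 1)) x0.
have cont : {within `[u, w], continuous (fun x : R => s * xm `^ s * x `^ (- (s + 1)))}.
  apply: continuous_in_subspaceT => x; rewrite inE /= in_itv /= => /andP[ux _].
  by apply: cvgMl_tmp; apply: der; exact: lt_le_trans ux.
rewrite integral_itv_bndo_bndc; last first.
  apply/measurable_EFinP; apply: measurable_funM => //.
  by apply: measurable_funTS; exact: measurable_powR.
have contF x : 0 < x -> {for x, continuous (fun y => - (xm `^ s * y `^ (- s)))}.
  move=> x0; apply: differentiable_continuous; apply/derivable1_diffP.
  by have [] := is_derive_pareto_primitive x0.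
rewrite (@continuous_FTC2 _ _ (fun y => - (xm `^ s * y `^ (- s))))//.
- rewrite -EFinB; congr (_%:E).
  by rewrite opprK !powRM ?invr_ge0 ?ltW// !powR_invl// addrC.
- split.
  + move=> x; rewrite in_itv /= => /andP[ux _].
    by have [] := is_derive_pareto_primitive (lt_trans u0 ux).
  + by apply: cvg_at_right_filter; exact: contF.
  + by apply: cvg_at_left_filter; exact: contF.
- move=> x; rewrite in_itv /= => /andP[ux _].
  have h := is_derive_pareto_primitive (lt_trans u0 ux).
  by rewrite derive1E derive_val.
Qed.

Lemma pareto_prob_itv u w : u <= w ->
  distribution P X `[u, w[ = (pareto_survival xm s u - pareto_survival xm s w)%:E.
Proof.
move=> uw.
have xu : xm <= Num.max xm u by rewrite le_max lexx.
have muw : Num.max xm u <= Num.max xm w by rewrite ge_max !le_max lexx uw orbT.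
rewrite -(pareto_prob_itv_ge xu muw).
rewrite !pareto_distributionE; try exact: measurable_itv.
congr (integral _ _ _); apply/seteqP; split => x;
  rewrite /= !in_itv /= !andbT => -[/andP[ux xw] xx]; split => //; apply/andP; split.
- by rewrite ge_max xx.
- by rewrite lt_max xw orbT.
- by move: ux; rewrite ge_max => /andP[].
- by move: xw; rewrite lt_max ltNge xx.
Qed.

Lemma pareto_prob_above A A' : measurable A -> measurable A' ->
  A `&` `[xm, +oo[%classic = A' `&` `[xm, +oo[%classic ->
  distribution P X A = distribution P X A'.
Proof. by move=> mA mA' AA'; rewrite !pareto_distributionE// AA'. Qed.

Lemma pareto_survival_le u : u <= xm -> pareto_survival xm s u = 1.
Proof. by move=> /max_idPl; rewrite /pareto_survival => ->; rewrite divff ?powR1// gt_eqF. Qed.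

Lemma pareto_survival_ge u : xm <= u -> pareto_survival xm s u = (xm / u) `^ s.
Proof. by move=> /max_idPr; rewrite /pareto_survival => ->. Qed.

End pareto_survival.

(** * The intervals on which a digit is constant *)

Lemma powRD_gt0 {R : realType} (x r s : R) : 0 < x ->
  x `^ (r + s) = x `^ r * x `^ s.
Proof. by move=> x0; rewrite powRD// (gt_eqF x0) implybT. Qed.

Section digit_cells.
Context {R : realType}.
Variables (b j a : nat).
Hypotheses (hb : (2 <= b)%N) (hj : (2 <= j)%N) (ha : (a < b)%N).
Implicit Types (x y : R) (l : int) (k : nat).
Local Notation B := (b%:R : R).

Let b0 : (0 < b)%N. Proof. exact: leq_trans hb. Qed.
Let B0 : 0 < B. Proof. by rewrite ltr0n. Qed.
Let B1 : 1 < B. Proof. by rewrite ltr1n. Qed.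
Let lnB : 0 < ln B. Proof. exact: ln_gt0. Qed.

Lemma powR_logb x : 0 < x -> B `^ logb b x = x.
Proof. by move=> x0; rewrite /powR gt_eqF// /logb divfK ?gt_eqF// lnK. Qed.

(** Integers of j digits are in this way scaled to numbers x with
    b^l <= x < b^(l+1). *)
Definition cell_scale l : R := B `^ (l%:~R - (j%:R - 1)).

Lemma cell_scale_gt0 l : 0 < cell_scale l.
Proof. by rewrite powR_gt0. Qed.

Lemma cell_scale_pow l : cell_scale l * B ^+ (j - 1) = B `^ l%:~R.
Proof.
rewrite /cell_scale -powR_mulrn ?ltW// -powRD_gt0//.
by rewrite natrB ?(leq_trans _ hj)// subrK.
Qed.

Lemma powR_int_succ l : B `^ (l + 1)%:~R = B * B `^ l%:~R.
Proof. by rewrite rmorphD /= powRD_gt0// powRr1 ?ltW// mulrC. Qed.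

Lemma floor_logbP x l : 0 < x ->
  (Num.floor (logb b x) = l) <-> (B `^ l%:~R <= x < B `^ (l + 1)%:~R).
Proof.
move=> x0.
have le_pow (r r' : R) : (B `^ r <= B `^ r') = (r <= r').
  by rewrite /powR gt_eqF// ler_expR ler_pM2r.
have E : (B `^ l%:~R <= x < B `^ (l + 1)%:~R) =
         (l%:~R <= logb b x < (l + 1)%:~R).
  by rewrite -[in LHS](powR_logb x0) ltNge !le_pow -ltNge.
rewrite E; split => [<-|/floor_def//]; exact: floor_itv.
Qed.

Lemma significandE x l : 0 < x -> Num.floor (logb b x) = l ->
  significand b j x = Num.floor (x / cell_scale l).
Proof.
move=> x0 xl; rewrite /significand /frac_part xl; congr Num.floor.
rewrite -[in RHS](powR_logb x0) /cell_scale -powRN -powRD_gt0//.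
by congr (_ `^ _); ring.
Qed.

(** The numbers in [b^l, b^(l+1)[ whose integer significand of length j is
    b k + a, that is, whose j-th digit is a after the leading digits k. *)
Definition cell l k : set R :=
  `[(b * k + a)%:R * cell_scale l, (b * k + a).+1%:R * cell_scale l[.

Lemma cellP l k x : cell l k x <-> Num.floor (x / cell_scale l) = (b * k + a)%:Z.
Proof.
rewrite /cell /= in_itv /= -ler_pdivlMr ?cell_scale_gt0//.
rewrite -ltr_pdivrMr ?cell_scale_gt0//; split => [h|E].
  by apply: floor_def; rewrite intrD mulr1z -pmulrn natr1.
by have := floor_itv (x / cell_scale l); rewrite E intrD mulr1z -pmulrn natr1.
Qed.

(** The numbers k formed by the first j - 1 digits. *)
Definition cell_range k := (b ^ (j - 2) <= k < b ^ (j - 1))%N.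

Lemma cell_range_bounds k : cell_range k ->
  (b ^ (j - 1) <= b * k + a)%N /\ ((b * k + a).+1 <= b ^ j)%N.
Proof.
have E1 : (b ^ (j - 1) = b * b ^ (j - 2))%N by rewrite -expnS; congr (_ ^ _)%N; lia.
have E2 : (b ^ j = b * b ^ (j - 1))%N by rewrite -expnS; congr (_ ^ _)%N; lia.
move=> /andP[k1 k2]; split.
  by rewrite E1 (leq_trans _ (leq_addr _ _))// leq_mul2l k1 orbT.
rewrite E2 (@leq_trans (b * k.+1))//; last by rewrite leq_mul2l k2 orbT.
by rewrite mulnS addnC -addSn leq_add2r.
Qed.

Lemma cell_floor_logb l k x : cell_range k -> cell l k x ->
  0 < x /\ Num.floor (logb b x) = l.
Proof.
move=> /cell_range_bounds[k1 k2]; rewrite /cell /= in_itv /= => /andP[h1 h2].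
have c0 := cell_scale_gt0 l.
have lo : B `^ l%:~R <= x.
  rewrite -cell_scale_pow (le_trans _ h1)// mulrC ler_wpM2r ?(ltW c0)//.
  by rewrite -natrX ler_nat.
have x0 : 0 < x by rewrite (lt_le_trans _ lo)// powR_gt0.
split=> //; apply/floor_logbP => //; rewrite lo (lt_le_trans h2)//.
rewrite powR_int_succ -cell_scale_pow mulrCA -exprS mulrC ler_wpM2l ?(ltW c0)//.
rewrite (_ : (j - 1).+1 = j); last by lia.
by rewrite -natrX ler_nat.
Qed.

Lemma digit_cell x : 0 < x ->
  digit b j x = a%:Z <->
  exists2 k, cell_range k & cell (Num.floor (logb b x)) k x.
Proof.
move=> x0; rewrite /digit; set l := Num.floor _.
rewrite (significandE x0 (erefl l)).
split=> [E|[k _ /cellP ->]]; last first.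
  by rewrite modz_nat mulnC modnMDl modn_small.
have [lo hi] : B `^ l%:~R <= x /\ x < B `^ (l + 1)%:~R.
  by apply/andP; apply/floor_logbP.
have c0 := cell_scale_gt0 l.
set y := x / cell_scale l in E.
have ylo : B ^+ (j - 1) <= y by rewrite ler_pdivlMr// mulrC cell_scale_pow.
have yhi : y < B ^+ j.
  rewrite ltr_pdivrMr// (lt_le_trans hi)// powR_int_succ -cell_scale_pow mulrCA -exprS.
  by rewrite (_ : (j - 1).+1 = j) 1?mulrC//; move: hj; lia.
have [n nE] : exists n : nat, Num.floor y = n%:Z.
  have : 0 <= Num.floor y by rewrite floor_ge_int (le_trans _ ylo)// exprn_ge0// ltW.
  by case: (Num.floor y) => // n _; exists n.
have n1 : (b ^ (j - 1) <= n)%N.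
  by rewrite -lez_nat -nE floor_ge_int -pmulrn natrX.
have n2 : (n < b ^ j)%N.
  by rewrite -ltz_nat -nE floor_lt_int -pmulrn natrX.
move: E; rewrite nE modz_nat => -[na].
exists (n %/ b)%N; last first.
  by apply/cellP; rewrite -/y nE mulnC -na -divn_eq.
have j1 : (j - 2).+1 = (j - 1)%N by lia.
have j2 : (j - 1).+1 = j by lia.
by rewrite /cell_range leq_divRL// ltn_divLR// -!expnSr j1 j2 n1.
Qed.

Lemma measurable_cell l k : measurable (cell l k).
Proof. exact: measurable_itv. Qed.

(** On nonpositive reals the logarithm is 0, so the digit is constant there; on
    positive reals its level set is a countable union of cells. *)
Lemma measurable_digit : measurable [set x : R | digit b j x = a%:Z].
Proof.
have -> : [set x : R | digit b j x = a%:Z] =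
    (`]-oo, 0] `&` [set x : R | digit b j (0 : R) = a%:Z]) `|`
    \bigcup_(lk : int * nat) (if cell_range lk.2 then cell lk.1 lk.2 else set0).
  apply/seteqP; split => x.
    have [x0|x0] := leP x 0 => /= xa.
      left; split; first by rewrite in_itv /=.
      by move: xa; rewrite /digit /significand /logb (ln0 x0) (ln0 (lexx 0)).
    have [k kr xk] := (digit_cell x0).1 xa.
    by right; exists (Num.floor (logb b x), k) => //=; rewrite kr.
  move=> [[/= x0 xa]|[[l k] _ /=]].
    rewrite in_itv /= in x0.
    by move: xa; rewrite /digit /significand /logb (ln0 x0) (ln0 (lexx 0)).
  case: ifP => // kr xk; have [x0 xl] := cell_floor_logb kr xk.
  by apply/(digit_cell x0); exists k => //; rewrite xl.
apply: measurableU.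
  apply: measurableI; first exact: measurable_itv.
  have [E|E] := pselect (digit b j (0 : R) = a%:Z).
    rewrite (_ : [set _ | _] = setT)//; by apply/seteqP; split.
  by rewrite (_ : [set _ | _] = set0)//; apply/seteqP; split.
apply: countable_bigcupT_measurable => //.
move=> [l k] /=; case: ifP => // _; exact: measurable_cell.
Qed.

Definition cell_union l : set R :=
  \big[setU/set0]_(i < b ^ (j - 1) - b ^ (j - 2)) cell l (b ^ (j - 2) + i).

Lemma cell_unionP l x : cell_union l x <-> exists2 k, cell_range k & cell l k x.
Proof.
rewrite /cell_union -(bigcup_mkord _ (fun i => cell l (b ^ (j - 2) + i))); split => [[i /= iK xi]|[k /andP[k1 k2] xk]].
  by exists (b ^ (j - 2) + i)%N => //; rewrite /cell_range leq_addr -ltn_subRL.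
exists (k - b ^ (j - 2))%N => /=; last by rewrite subnKC.
by rewrite ltn_sub2r// (leq_ltn_trans k1).
Qed.

Lemma measurable_cell_union l : measurable (cell_union l).
Proof. by apply: bigsetU_measurable => i _; exact: measurable_cell. Qed.

Lemma trivIset_cell l : trivIset setT (fun i => cell l (b ^ (j - 2) + i)).
Proof.
move=> i i' _ _ [x [/cellP E /cellP]]; rewrite E => -[] /eqP.
by rewrite eqn_add2r eqn_mul2l gtn_eqF//= eqn_add2l => /eqP.
Qed.

Lemma trivIset_cell_union (l : int) : trivIset setT (fun m : nat => cell_union (l + m%:Z)).
Proof.
move=> m m' _ _ [x [/cell_unionP[k kr xk] /cell_unionP[k' kr' xk']]].
have [_ E] := cell_floor_logb kr xk; have [_ E'] := cell_floor_logb kr' xk'.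
by move: E'; rewrite E => /addrI [].
Qed.

End digit_cells.

(** * Summation over the intervals *)

Section tau_differences.
Context {R : realType}.
Implicit Types (s v w : R).

(** The only property of the digamma and Hurwitz zeta functions that the
    probability computation uses. *)
Lemma tau_shift s v : 0 < s -> 1 <= v -> tau s v - tau s (v + 1) = v `^ (- s).
Proof.
move=> s0 v1; rewrite /tau; have [->|s1] := eqVneq s 1; last exact: hurwitz_zeta_shift.
rewrite opprK addrC digamma_shift// powR_inv1//.
exact: le_trans v1.
Qed.

Lemma tau_sum s w (m n : nat) : 0 < s -> 1 <= w + m%:R -> (m <= n)%N ->
  \sum_(m <= k < n) (w + k%:R) `^ (- s) = tau s (w + m%:R) - tau s (w + n%:R).
Proof.
move=> s0 wm mn.
rewrite (eq_big_nat _ _ (F2 := fun k => (- tau s (w + k.+1%:R)) - (- tau s (w + k%:R)))).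
  by rewrite telescope_sumr// opprK addrC.
move=> k /andP[mk _]; rewrite opprK -natr1 addrA [RHS]addrC.
have wk : 1 <= w + k%:R by rewrite (le_trans wm)// lerD2l ler_nat.
exact/esym/tau_shift.
Qed.

End tau_differences.

Section pareto_digit.
Context {R : realType}.
Variables (b j : nat) (xm s : R).
Hypotheses (hb : (2 <= b)%N) (hj : (2 <= j)%N) (hxm : 0 < xm) (hs : 0 < s).
Local Notation B := (b%:R : R).
Let b0 : (0 < b)%N. Proof. exact: leq_trans hb. Qed.
Let B0 : 0 < B. Proof. by rewrite ltr0n. Qed.
Let B1 : 1 < B. Proof. by rewrite ltr1n. Qed.
Let lnB : 0 < ln B. Proof. exact: ln_gt0. Qed.

Local Notation L := (Num.floor (logb b xm)).
Local Notation N1 := (b ^ (j - 1))%N.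
Local Notation N2 := (b ^ (j - 2))%N.

Definition scaled_exponent : R := frac_part (logb b xm) + j%:R - 1.
Local Notation xi := scaled_exponent.
Local Notation y0 := (B `^ (xi - 1)).

(** The least integer k with b k + v >= b^xi: at the scale of xm, the bounds of
    smaller index k are those below xm. *)
Definition threshold (v : nat) : int := Num.ceil (y0 - v%:R / B).
Local Notation eta := threshold.

Let N2_ge1 : (1 <= N2)%N. Proof. by rewrite expn_gt0 b0. Qed.
Let N12 : (N2 <= N1)%N. Proof. by rewrite leq_exp2l//; lia. Qed.

Let rho01 : 0 <= frac_part (logb b xm) < 1.
Proof.
rewrite /frac_part; have := floor_itv (logb b xm); rewrite intrD mulr1z.
by move=> /andP[h1 h2]; apply/andP; split; lra.
Qed.

Let powR_expn (n : nat) : B `^ n%:R = (b ^ n)%:R.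
Proof. by rewrite powR_mulrn ?ltW// natrX. Qed.

Let powR_mono (r r' : R) : (B `^ r <= B `^ r') = (r <= r').
Proof. by rewrite /powR gt_eqF// ler_expR ler_pM2r. Qed.

Let y0_ge : N2%:R <= y0.
Proof.
rewrite -powR_expn powR_mono /scaled_exponent natrB//.
by case/andP: rho01 => h _; lra.
Qed.

Let y0_le : y0 <= N1%:R.
Proof.
rewrite -powR_expn powR_mono /scaled_exponent natrB ?(leq_trans _ hj)//.
by case/andP: rho01 => _ h; lra.
Qed.

Let y0_gt0 : 0 < y0. Proof. by rewrite powR_gt0. Qed.

(** For v = a and v = a + 1 these are the two bounds of the cell of k at scale
    L + m. *)
Definition cell_bound (v m k : nat) : R := (b * k + v)%:R * @cell_scale R b j (L + m%:Z).
Local Notation bound := cell_bound.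

Lemma xm_div_bound v m k : (0 < k)%N ->
  xm / bound v m k = B `^ (xi - 1 - m%:R) / (v%:R / B + k%:R).
Proof.
move=> k0; rewrite /cell_bound -{1}(powR_logb hb hxm).
have kb : 0 < (b * k + v)%:R :> R by rewrite ltr0n addn_gt0 muln_gt0 b0 k0.
have -> : v%:R / B + k%:R = (b * k + v)%:R / B.
  by rewrite natrD natrM; field; rewrite gt_eqF.
have -> : B `^ (logb b xm) = B * B `^ (xi - 1 - m%:R) * @cell_scale R b j (L + m%:Z).
  rewrite -[X in X * _ * _]powRr1 ?ltW// /cell_scale -!powRD_gt0//; congr (_ `^ _).
  by rewrite /scaled_exponent /frac_part intrD -pmulrn; ring.
have c0 : 0 < @cell_scale R b j (L + m%:Z) by exact: cell_scale_gt0.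
by field; rewrite -natrM -natrD !gt_eqF.
Qed.

Lemma powR_scaled (r y : R) : 0 < y -> (B `^ r / y) `^ s = B `^ (s * r) * y `^ (- s).
Proof.
move=> yp; rewrite powRM ?powR_ge0 ?invr_ge0 ?ltW// powR_invl//.
by rewrite -powRrM mulrC [r * s]mulrC mulrC.
Qed.

Lemma bound_gt0 v m k : (0 < k)%N -> 0 < bound v m k.
Proof.
by move=> k0; rewrite mulr_gt0 ?cell_scale_gt0// ltr0n addn_gt0 muln_gt0 b0 k0.
Qed.

Lemma xm_le_bound v m k : (0 < k)%N ->
  (xm <= bound v m k) = (B `^ (xi - 1 - m%:R) <= v%:R / B + k%:R).
Proof.
move=> k0; have kp : 0 < v%:R / B + k%:R by rewrite ltr_wpDl ?divr_ge0 ?ltr0n// ltW.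
by rewrite -[X in xm <= X]mul1r -ler_pdivrMr ?bound_gt0// xm_div_bound// ler_pdivrMr// mul1r.
Qed.

Lemma survival_bound v m k : (0 < k)%N ->
  B `^ (xi - 1 - m%:R) <= v%:R / B + k%:R ->
  pareto_survival xm s (bound v m k) =
  B `^ (s * (xi - 1 - m%:R)) * (v%:R / B + k%:R) `^ (- s).
Proof.
move=> k0; rewrite -xm_le_bound// => le_m.
rewrite pareto_survival_ge// xm_div_bound// powR_scaled//.
by rewrite ltr_wpDl ?divr_ge0 ?ltr0n// ltW.
Qed.

(** Once all bounds are at least xm the survival function is a pure power and
    the sum over k telescopes. *)
Lemma bound_sum_ge (v m n1 n2 : nat) : (0 < n1)%N -> (n1 <= n2)%N ->
  B `^ (xi - 1 - m%:R) <= v%:R / B + n1%:R ->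
  \sum_(n1 <= k < n2) pareto_survival xm s (bound v m k) =
  B `^ (s * (xi - 1 - m%:R)) * (tau s (v%:R / B + n1%:R) - tau s (v%:R / B + n2%:R)).
Proof.
move=> n10 n12 le_n1; have vB : 0 <= v%:R / B by rewrite divr_ge0// ltW.
rewrite -tau_sum//; last by rewrite ler_wpDl// ler1n.
rewrite mulr_sumr; apply: eq_big_nat => k /andP[nk _].
apply: survival_bound; first exact: leq_trans nk.
by rewrite (le_trans le_n1)// lerD2l ler_nat.
Qed.

(** From the scale above that of xm on, each scale contributes b^(-s) times the
    previous one. *)
Lemma bound_sumS (v m : nat) :
  \sum_(N2 <= k < N1) pareto_survival xm s (bound v m.+1 k) =
  B `^ (s * (xi - 2)) * (B `^ (- s)) ^+ m *
  (tau s (v%:R / B + N2%:R) - tau s (v%:R / B + N1%:R)).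
Proof.
rewrite bound_sum_ge//.
  rewrite -powR_mulrn ?powR_ge0// -powRrM -powRD_gt0//.
  by congr (_ `^ _ * _); rewrite -natr1; ring.
rewrite (@le_trans _ _ N2%:R)//; last by rewrite lerDr divr_ge0// ltW.
rewrite -powR_expn powR_mono /scaled_exponent natrB// -natr1.
by case/andP: rho01 => _ h; have := ler0n R m; lra.
Qed.

(** The bounds below xm contribute 1 each; they are those of index below eta v.
    When xm is a power of b and v = b, eta v is b^(j-2) - 1, one less than the
    first index, and the formula holds because the extra term is 1. *)
Lemma bound_sum0 (v : nat) : (v <= b)%N ->
  \sum_(N2 <= k < N1) pareto_survival xm s (bound v 0 k) =
  (eta v)%:~R - N2%:R +
  B `^ (s * (xi - 1)) * (tau s (v%:R / B + (eta v)%:~R) - tau s (v%:R / B + N1%:R)).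
Proof.
move=> vb.
have vB0 : 0 <= v%:R / B by rewrite divr_ge0// ltW.
have vB1 : v%:R / B <= 1 by rewrite ler_pdivrMr// mul1r ler_nat.
have eta_le (n : int) : (eta v <= n) = (y0 <= v%:R / B + n%:~R).
  by rewrite /threshold ceil_le_int lerBlDl.
have N2_ge1R : 1 <= N2%:R :> R by rewrite ler1n.
have [|] := lerP (N2%:Z) (eta v).
  case E : (eta v) => [n|//]; rewrite lez_nat => N2n.
  have nN1 : (n <= N1)%N.
    by rewrite -lez_nat -E eta_le -pmulrn (le_trans y0_le)// lerDr.
  rewrite (big_cat_nat (n := n))//= -pmulrn; congr (_ + _).
    rewrite (eq_big_nat _ _ (F2 := fun=> 1)).
      by rewrite sumr_const_nat natrB.
    move=> k /andP[N2k kn]; apply: pareto_survival_le => //.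
    rewrite ltW// ltNge xm_le_bound ?(leq_trans N2_ge1)// subr0.
    by have := eta_le k%:Z; rewrite -pmulrn => <-; rewrite E lez_nat -ltnNge.
  rewrite bound_sum_ge ?subr0//; first exact: leq_trans N2n.
  by have := eta_le n%:Z; rewrite -pmulrn => <-; rewrite E.
move=> etaN2.
have le1 : y0 <= v%:R / B + (eta v)%:~R by rewrite -eta_le.
have le2 : (eta v)%:~R + 1 <= N2%:R :> R.
  have : ((eta v + 1)%:~R <= (N2%:Z)%:~R :> R) by rewrite ler_int lezD1.
  by rewrite intrD mulr1z -pmulrn.
have etaE : (eta v)%:~R = N2%:R - 1 :> R by have := y0_ge; lra.
have y0E : v%:R / B + (N2%:R - 1) = y0 by have := y0_ge; rewrite etaE in le1; lra.
rewrite bound_sum_ge ?subr0//; last by have := y0_ge; lra.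
rewrite etaE.
have := @tau_shift R s (v%:R / B + (N2%:R - 1)) hs.
rewrite y0E => /(_ (le_trans N2_ge1R y0_ge)).
have -> : y0 + 1 = v%:R / B + N2%:R by rewrite -y0E; ring.
have : B `^ (s * (xi - 1)) * y0 `^ (- s) = 1.
  by rewrite -powRrM -powRD_gt0// mulrN [_ * s]mulrC subrr powRr0.
set c := B `^ _; set u := y0 `^ _; set t0 := tau s y0.
set t1 := tau s _; set t2 := tau s _ => cu ut.
have -> : t0 = u + t1 by rewrite -ut subrK.
have -> : c * (u + t1 - t2) = c * u + c * (t1 - t2) by ring.
by rewrite cu; ring.
Qed.

End pareto_digit.

(** * The law of a digit *)

Lemma powR_gt1 {R : realType} (x r : R) : 1 < x -> 0 < r -> 1 < x `^ r.
Proof.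
move=> x1 r0; rewrite /powR gt_eqF ?(lt_trans _ x1)// expR_gt1.
by rewrite mulr_gt0// ln_gt0.
Qed.

Lemma sum_nat_shift (V : nmodType) (F : nat -> V) (m n : nat) :
  \sum_(m <= k < n) F k = \sum_(i < n - m) F (m + i)%N.
Proof.
rewrite -{1}[m]add0n big_addn big_mkord.
by apply: eq_bigr => i _; rewrite addnC.
Qed.

Section digit_law.
Context {R : realType} {d : measure_display} {T : measurableType d}.
Context {P : probability T R} {X : {RV P >-> R}} {xm s : R}.
Variables (b j a : nat).
Hypotheses (hb : (2 <= b)%N) (hj : (2 <= j)%N) (ha : (a < b)%N).
Hypotheses (hxm : 0 < xm) (hs : 0 < s) (hX : is_pareto X xm s).
Local Notation B := (b%:R : R).
Local Notation L := (Num.floor (logb b xm)).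
Local Notation N1 := (b ^ (j - 1))%N.
Local Notation N2 := (b ^ (j - 2))%N.
Local Notation xi := (scaled_exponent b j xm).
Local Notation eta := (threshold b j xm).
Local Notation bound := (cell_bound b j xm).
Local Notation surv := (pareto_survival xm s).

Let B0 : 0 < B. Proof. by rewrite ltr0n (leq_trans _ hb). Qed.
Let B1 : 1 < B. Proof. by rewrite ltr1n. Qed.

Lemma digit_set_cells :
  [set x | digit b j x = a%:Z] `&` `[xm, +oo[%classic =
  (\bigcup_m cell_union b j a (L + m%:Z)) `&` (`[xm, +oo[%classic : set R).
Proof.
apply/seteqP; split => x; rewrite /= in_itv /= andbT => -[xA xx].
  have x0 : 0 < x by exact: lt_le_trans xx.
  split=> //; have [k kr xk] := (digit_cell hb hj ha x0).1 xA.
  have lnB : 0 < ln B by exact: ln_gt0.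
  have Ll : L <= Num.floor (logb b x).
    by apply: le_floor; rewrite ler_pM2r ?invr_gt0// ler_ln.
  exists `|Num.floor (logb b x) - L|%N => //=.
  by rewrite gez0_abs ?subr_ge0// [L + _]addrC subrK; apply/cell_unionP; exists k.
split=> //; move: xA => [m _ /cell_unionP[k kr xk]].
have [x0 xl] := cell_floor_logb hb hj ha kr xk.
by apply/(digit_cell hb hj ha x0); exists k => //; rewrite xl.
Qed.

(** The probability of digit a at the m-th scale b^(L+m) <= X < b^(L+m+1), with
    L the integer part of log_b xm. *)
Definition scale_mass (m : nat) : R :=
  \sum_(N2 <= k < N1) (surv (bound a m k) - surv (bound a.+1 m k)).

Lemma distribution_cell_union m :
  distribution P X (cell_union b j a (L + m%:Z)) = (scale_mass m)%:E.
Proof.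
rewrite /cell_union (measure_bigsetU (distribution P X)
  (F := fun i => @cell R b j a (L + m%:Z) (N2 + i)%N)); [|by move=> i; exact: measurable_cell|exact: trivIset_cell].
rewrite /scale_mass sum_nat_shift -sumEFin; apply: eq_bigr => i _.
have le_b : bound a m (N2 + i) <= bound a.+1 m (N2 + i).
  by rewrite ler_wpM2r ?ler_nat ?leq_add2l// ltW// cell_scale_gt0.
by have := pareto_prob_itv hxm hX le_b; rewrite /cell_bound addnS.
Qed.

Let D v : R := tau s (v%:R / B + N2%:R) - tau s (v%:R / B + N1%:R).

Lemma scale_mass0 : scale_mass 0 =
  (eta a)%:~R - (eta a.+1)%:~R +
  B `^ (s * (xi - 1)) * (tau s (a%:R / B + (eta a)%:~R) - tau s (a.+1%:R / B + (eta a.+1)%:~R)) -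
  B `^ (s * (xi - 1)) * (tau s (a%:R / B + N1%:R) - tau s (a.+1%:R / B + N1%:R)).
Proof.
rewrite /scale_mass sumrB.
rewrite (bound_sum0 hb hj hxm hs (ltnW ha)).
rewrite (bound_sum0 hb hj hxm hs ha).
move: (tau s (a%:R / B + (eta a)%:~R)) (tau s (a.+1%:R / B + (eta a.+1)%:~R)).
move: (tau s (a%:R / B + N1%:R)) (tau s (a.+1%:R / B + N1%:R)).
move: (B `^ _) ((eta a)%:~R : R) ((eta a.+1)%:~R : R) (N2%:R : R) => *; ring.
Qed.

Lemma scale_massS m : scale_mass m.+1 =
  B `^ (s * (xi - 2)) * (D a - D a.+1) * (B `^ (- s)) ^+ m.
Proof.
rewrite /scale_mass sumrB.
rewrite (bound_sumS hb hj hxm hs a m) (bound_sumS hb hj hxm hs a.+1 m) -/(D a) -/(D a.+1).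
by move: (D a) (D a.+1) (B `^ _) (_ ^+ m) => *; ring.
Qed.

Lemma cvg_scale_mass : series scale_mass @ \oo -->
  scale_mass 0 + B `^ (s * (xi - 2)) * (D a - D a.+1) * (1 - B `^ (- s))^-1.
Proof.
rewrite -(cvg_shiftn 1).
have -> : (fun n => series scale_mass (n + 1)%N) = fun n => scale_mass 0 +
    series (geometric (B `^ (s * (xi - 2)) * (D a - D a.+1)) (B `^ (- s))) n.
  apply/funext => n; rewrite addn1 /series /= big_nat_recl//=; congr (_ + _).
  by apply: eq_bigr => i _; rewrite scale_massS.
apply: cvgD; first exact: cvg_cst.
apply: cvg_geometric_series; rewrite ger0_norm ?powR_ge0//.
by rewrite powRN invf_lt1 ?powR_gt0// powR_gt1.
Qed.

Lemma distribution_digit : distribution P X [set x | digit b j x = a%:Z] =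
  (scale_mass 0 + B `^ (s * (xi - 2)) * (D a - D a.+1) * (1 - B `^ (- s))^-1)%:E.
Proof.
have mU : measurable (\bigcup_m cell_union b j a (L + m%:Z) : set R).
  by apply: bigcupT_measurable => m; exact: measurable_cell_union.
rewrite (pareto_prob_above hX _ mU digit_set_cells); last exact: measurable_digit.
have h : (EFin \o series scale_mass) @ \oo -->
    distribution P X (\bigcup_m cell_union b j a (L + m%:Z)).
  have -> : EFin \o series scale_mass = fun n =>
      (\sum_(0 <= m < n) distribution P X (cell_union b j a (L + m%:Z)))%E.
    apply/funext => n; rewrite /= /series /= -sumEFin; apply: eq_bigr => m _.
    by rewrite distribution_cell_union.
  apply: measure_semi_sigma_additive => //; last exact: trivIset_cell_union.
  by move=> m; exact: measurable_cell_union.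
apply: (cvg_unique _ h) => //.
by apply: cvg_EFin; [exact: nearW|exact: cvg_scale_mass].
Qed.

End digit_law.

Theorem mainTheorem8 (d : measure_display) (T : measurableType d)
    (R : realType) (P : probability T R) (X : {RV P >-> R})
    (b j : nat) (hb : (2 <= b)%N) (hj : (2 <= j)%N)
    (xm s : R) (hxm : 0 < xm) (hs : 0 < s) (hX : is_pareto X xm s)
    (a : nat) (ha : (a < b)%N) :
  let B : R := b%:R in
  let rho : R := frac_part (logb b xm) in
  let xi : R := rho + j%:R - 1 in
  let eta (v : nat) : R := (Num.ceil (B `^ (xi - 1) - v%:R / B))%:~R in
  P [set t | digit b j (X t) = a%:Z] =
  (B `^ (s * (xi - 2)) / (1 - B `^ (- s)) *
     (tau s (a%:R / B + B ^+ (j - 2)) - tau s (a.+1%:R / B + B ^+ (j - 2)))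
   - B `^ (s * (xi - 1)) / (1 - B `^ (- s)) *
     (tau s (a%:R / B + B ^+ (j - 1)) - tau s (a.+1%:R / B + B ^+ (j - 1)))
   + B `^ (s * (xi - 1)) *
     (tau s (a%:R / B + eta a) - tau s (a.+1%:R / B + eta a.+1))
   + eta a - eta a.+1)%:E.
Proof.
move=> B rho xi eta.
have B0 : 0 < B by rewrite ltr0n (leq_trans _ hb).
have q1 : 1 - B `^ (- s) != 0.
  by rewrite gt_eqF// subr_gt0 powRN invf_lt1 ?powR_gt0// powR_gt1 ?ltr1n.
have := distribution_digit hb hj ha hxm hs hX; rewrite {1}/distribution /pushforward => ->.
congr (_%:E); rewrite scale_mass0//.
have -> : scaled_exponent b j xm = xi by [].
have etaE v : (threshold b j xm v)%:~R = eta v by [].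
rewrite !etaE -/B !natrX -/B.
have -> : B `^ (s * (xi - 2)) = B `^ (s * (xi - 1)) * B `^ (- s).
  by rewrite -powRD_gt0//; congr (_ `^ _); ring.
clearbody eta; move: (tau s (a%:R / B + eta a)) (tau s (a.+1%:R / B + eta a.+1)).
move: (tau s (a%:R / B + B ^+ (j - 2))) (tau s (a.+1%:R / B + B ^+ (j - 2))).
move: (tau s (a%:R / B + B ^+ (j - 1))) (tau s (a.+1%:R / B + B ^+ (j - 1))).
move: (B `^ (s * (xi - 1))) (B `^ (- s)) q1 (eta a) (eta a.+1) => c q q1 e e' *.
by field.
Qed.
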